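(* Let $\mathbb F$ be an algebraically closed field of characteristic other than two. (a) The problem of classifying, up to isomorphism, local commutative associative algebras $\Lambda$ over $\mathbb F$ with $(\operatorname{Rad}\Lambda)^3=0$ and $\dim(\operatorname{Rad}\Lambda)^2=3$ is wild. (b) The problem of classifying, up to isomorphism, Lie algebras over $\mathbb F$ with central commutator subalgebra of dimension $3$ is wild.
   Context: All algebras are finite-dimensional over $\mathbb F$. In (a), an algebra is associative with identity $1$. An algebra $\Lambda$ is local if the set $R$ of its noninvertible elements is closed under addition; then $R=\operatorname{Rad}\Lambda$ is the radical and $\Lambda/R\cong\mathbb F$. Here $R^2$ and $R^3$ denote the subspaces spanned by all products $ab$ and $abc$ with $a,b,c\in R$. For a Lie algebra $L$, the commutator subalgebra $L^2$ is the subspace spanned by all $[a,b]$, $a,b\in L$; it is central if $[[a,b],c]=0$ for all $a,b,c\in L$. A classification problem is called wild if it contains the problem of classifying pairs of $n\times n$ matrices over $\mathbb F$ (all $n$) up to simultaneous similarity $(A,B)\mapsto(S^{-1}AS,S^{-1}BS)$. For the present problems this means the following. There is a fixed triple $(T_1(x,y),T_2(x,y),T_3(x,y))$ of $m\times m$ matrices whose entries are noncommutative polynomials over $\mathbb F$ in $x,y,x^T,y^T$; for each $n\ge1$ and each pair $(A,B)$ of $n\times n$ matrices, let $T_k(A,B)$ be the $mn\times mn$ matrix obtained by substituting $A,B,A^T,B^T$ for $x,y,x^T,y^T$ (each scalar constant $c$ being replaced by $cI_n$). Let $R(A,B)$ be the vector space with basis $e_1,e_2,e_3,f_1,\dots,f_{mn}$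 and bilinear multiplication given by $f_if_j=\sum_{k=1}^3 (T_k(A,B))_{ij}\,e_k$, all other products of basis vectors being $0$. Then, in case (b), $R(A,B)$ is always a Lie algebra of the class considered, and, in case (a), $R(A,B)$ is always the radical of the algebra $\Lambda(A,B)=\mathbb F1\oplus R(A,B)$ (with $1$ adjoined as identity), which belongs to the class considered; and for all pairs of $n\times n$ matrices, $(A,B)$ and $(C,D)$ are similar if and only if the algebras assigned to them ($\Lambda(A,B)$ and $\Lambda(C,D)$ in case (a), $R(A,B)$ and $R(C,D)$ in case (b)) are isomorphic. *)

(* Defs.v *)
From HB Require Import structures.
From mathcomp Require Import all_boot all_order all_algebra all_field.
From mathcomp Require Import monalg.

Set Implicit Arguments.
Unset Strict Implicit.
Unset Printing Implicit Defensive.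

Import GRing.Theory.
Local Open Scope ring_scope.

Definition is_span (F : fieldType) (V : vectType F) (S : V -> Prop)
    (U : {vspace V}) : Prop :=
  (forall v, S v -> v \in U) /\
  (forall W : {vspace V}, (forall v, S v -> v \in W) -> (U <= W)%VS).

Definition span_has_dim (F : fieldType) (V : vectType F) (S : V -> Prop)
    (d : nat) : Prop :=
  exists U : {vspace V}, is_span S U /\ \dim U = d.

(* Finite-dimensional algebras, not assumed to be associative or unital. *)
HB.mixin Record Vector_isNonassocAlgebra (F : fieldType) A of Vector F A := {
  amul : A -> A -> A;
  amulPl : forall (c : F) (x y z : A),
    amul (c *: x + y) z = c *: amul x z + amul y z;
  amulPr : forall (c : F) (x y z : A),
    amul x (c *: y + z) = c *: amul x y + amul x z
}.

#[short(type="nonassocAlgType")]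
HB.structure Definition NonassocAlgebra (F : fieldType) :=
  { A of Vector F A & Vector_isNonassocAlgebra F A }.

Section Lie.

Variables (F : fieldType).

Definition is_lie (L : nonassocAlgType F) : Prop :=
  (forall x : L, amul x x = 0) /\
  (forall x y z : L,
     amul (amul x y) z + amul (amul y z) x + amul (amul z x) y = 0).

Definition commutators (L : nonassocAlgType F) (v : L) : Prop :=
  exists a b : L, v = amul a b.

Definition lie_class (L : nonassocAlgType F) : Prop :=
  [/\ is_lie L,
      forall a b c : L, amul (amul a b) c = 0
    & span_has_dim (@commutators L) 3].

Definition nonassoc_iso (L1 L2 : nonassocAlgType F) : Prop :=
  exists f : {linear L1 -> L2},
    bijective f /\ (forall x y : L1, f (amul x y) = amul (f x) (f y)).

End Lie.

Section Local.

Variables (F : fieldType).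

Definition is_local (A : falgType F) : Prop :=
  forall x y : A, x \isn't a GRing.unit -> y \isn't a GRing.unit ->
    x + y \isn't a GRing.unit.

(* For local A, the nonunits are the elements of the radical. *)
Definition rad_prod2 (A : falgType F) (v : A) : Prop :=
  exists a b : A, [/\ a \isn't a GRing.unit, b \isn't a GRing.unit
                    & v = a * b].

Definition rad_prod3 (A : falgType F) (v : A) : Prop :=
  exists a b c : A, [/\ a \isn't a GRing.unit, b \isn't a GRing.unit,
                        c \isn't a GRing.unit & v = a * b * c].

Definition local_class (A : falgType F) : Prop :=
  [/\ is_local A,
      commutative (@GRing.mul A),
      is_span (@rad_prod3 A) 0%VS
    & span_has_dim (@rad_prod2 A) 3].

Definition falg_iso (A1 A2 : falgType F) : Prop :=
  exists f : {lrmorphism A1 -> A2}, bijective f.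

End Local.

(* [table_alg M] is the algebra R with basis e_0, e_1, e_2, f_0, ..., f_(N-1)
   and multiplication f_i f_j = \sum_k M k i j e_k, all other products of
   basis vectors being 0 (see [amul_ff], [amul_el] and [amul_er]).  The two
   components of an element are its e- and f-coordinates. *)
Definition table_alg (F : fieldType) (N : nat) (M : 'I_3 -> 'M[F]_N) : Type :=
  ('rV[F]_3 * 'rV[F]_N)%type.

Section TableAlgebra.

Variables (F : fieldType) (N : nat) (M : 'I_3 -> 'M[F]_N).
Local Notation R := (table_alg M).

HB.instance Definition _ := Vector.copy R ('rV[F]_3 * 'rV[F]_N)%type.

Definition table_mul (u v : R) : R :=
  (\row_k (u.2 *m M k *m v.2^T) 0 0, 0).

Fact table_mulPl (c : F) (x y z : R) :
  table_mul (c *: x + y) z = c *: table_mul x z + table_mul y z.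
Proof.
congr pair; last by rewrite /= scaler0 addr0.
by apply/rowP=> k /=; rewrite mxE !mulmxDl -!scalemxAl !mxE.
Qed.

Fact table_mulPr (c : F) (x y z : R) :
  table_mul x (c *: y + z) = c *: table_mul x y + table_mul x z.
Proof.
congr pair; last by rewrite /= scaler0 addr0.
by apply/rowP=> k /=; rewrite mxE linearP /= mulmxDr -scalemxAr !mxE.
Qed.

HB.instance Definition _ :=
  Vector_isNonassocAlgebra.Build F R table_mulPl table_mulPr.

Definition basis_e (k : 'I_3) : R := (delta_mx 0 k, 0).
Definition basis_f (i : 'I_N) : R := (0, delta_mx 0 i).

Lemma amul_ff (i j : 'I_N) :
  amul (basis_f i) (basis_f j) = \sum_(k < 3) M k i j *: basis_e k.
Proof.
have -> : \sum_(k < 3) M k i j *: basis_e k = (\row_k M k i j, 0).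
  rewrite !big_ord_recl big_ord0; congr pair; last first.
    by rewrite /= !scaler0 !addr0.
  apply/rowP=> k /=; rewrite !mxE /=.
  case: k => [[|[|[|//]]] hk] /=;
    rewrite ?(mulr0, mulr1, addr0, add0r); congr (M _ i j); exact: val_inj.
congr pair; apply/rowP=> k.
rewrite /= [LHS]mxE [RHS]mxE trmx_delta.
by rewrite -rowE -colE !mxE.
Qed.

Lemma amul_el (k : 'I_3) (x : R) : amul (basis_e k) x = 0.
Proof. by congr pair; apply/rowP=> l /=; rewrite mxE !mul0mx !mxE. Qed.

Lemma amul_er (k : 'I_3) (x : R) : amul x (basis_e k) = 0.
Proof. by congr pair; apply/rowP=> l /=; rewrite mxE trmx0 mulmx0 !mxE. Qed.

Lemma amul_nil3l (x y z : R) : amul (amul x y) z = 0.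
Proof. by congr pair; apply/rowP=> l /=; rewrite mxE !mul0mx !mxE. Qed.

Lemma amul_nil3r (x y z : R) : amul x (amul y z) = 0.
Proof. by congr pair; apply/rowP=> l /=; rewrite mxE trmx0 mulmx0 !mxE. Qed.

End TableAlgebra.

Section BilinearTheory.

Variables (F : fieldType) (R : nonassocAlgType F).
Implicit Types x y z : R.

Lemma amulDl x y z : amul (x + y) z = amul x z + amul y z.
Proof. by have := amulPl 1 x y z; rewrite !scale1r. Qed.

Lemma amulDr x y z : amul x (y + z) = amul x y + amul x z.
Proof. by have := amulPr 1 x y z; rewrite !scale1r. Qed.

Lemma amul0l z : amul 0 z = 0.
Proof. by apply: (addrI (amul 0 z)); rewrite -amulDl !addr0. Qed.

Lemma amul0r z : amul z 0 = 0.
Proof. by apply: (addrI (amul z 0)); rewrite -amulDr !addr0. Qed.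

Lemma amulZl c x z : amul (c *: x) z = c *: amul x z.
Proof. by have := amulPl c x 0 z; rewrite addr0 amul0l addr0. Qed.

Lemma amulZr c x z : amul x (c *: z) = c *: amul x z.
Proof. by have := amulPr c x z 0; rewrite addr0 amul0r addr0. Qed.

End BilinearTheory.

(* [unitization M] is F 1 (+) table_alg M, with 1 = (1, 0) adjoined as an
   identity.  It is associative for every M because all triple products in
   table_alg M vanish. *)
Definition unitization (F : fieldType) (N : nat) (M : 'I_3 -> 'M[F]_N) : Type :=
  (F^o * table_alg M)%type.

Section Unitization.

Variables (F : fieldType) (N : nat) (M : 'I_3 -> 'M[F]_N).
Local Notation L := (unitization M).

HB.instance Definition _ := Vector.copy L (F^o * table_alg M)%type.

Definition unitization_one : L := (1, 0).
Definition unitization_mul (x y : L) : L :=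
  (x.1 * y.1, (x.1 : F) *: y.2 + (y.1 : F) *: x.2 + amul x.2 y.2).

Fact unitization_mulA : associative unitization_mul.
Proof.
move=> [a u] [b v] [c w]; congr pair => /=; first by rewrite mulrA.
rewrite !scalerDr !amulDl !amulDr !amulZl !amulZr amul_nil3l amul_nil3r.
rewrite !addr0 !scalerA [c * a]mulrC [c * b]mulrC -!addrA.
by do 2 congr (_ + _); rewrite addrCA; congr (_ + _); rewrite addrA addrC.
Qed.

Fact unitization_mul1l : left_id unitization_one unitization_mul.
Proof.
move=> [a u]; congr pair => /=; first by rewrite mul1r.
by rewrite amul0l scaler0 scale1r !addr0.
Qed.

Fact unitization_mul1r : right_id unitization_one unitization_mul.
Proof.
move=> [a u]; congr pair => /=; first by rewrite mulr1.
by rewrite amul0r scaler0 scale1r add0r addr0.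
Qed.

Fact unitization_mulDl : left_distributive unitization_mul +%R.
Proof.
move=> [a u] [b v] [c w]; congr pair => /=; first by rewrite mulrDl.
by rewrite scalerDl scalerDr amulDl [RHS]addrACA; congr (_ + _); rewrite addrACA.
Qed.

Fact unitization_mulDr : right_distributive unitization_mul +%R.
Proof.
move=> [a u] [b v] [c w]; congr pair => /=; first by rewrite mulrDr.
by rewrite scalerDl scalerDr amulDr [RHS]addrACA; congr (_ + _); rewrite addrACA.
Qed.

Fact unitization_1neq0 : unitization_one != 0.
Proof. by apply/eqP=> -[] /eqP; rewrite oner_eq0. Qed.

HB.instance Definition _ := GRing.Zmodule_isNzRing.Build L
  unitization_mulA unitization_mul1l unitization_mul1r
  unitization_mulDl unitization_mulDr unitization_1neq0.

Fact unitization_scaleAl (c : F) (x y : L) : c *: (x * y) = (c *: x) * y.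
Proof.
congr pair => /=; first exact: mulrA.
by rewrite !scalerDr amulZl !scalerA [c * y.1]mulrC.
Qed.

HB.instance Definition _ :=
  GRing.Lmodule_isLalgebra.Build F L unitization_scaleAl.

Fact unitization_scaleAr (c : F) (x y : L) : c *: (x * y) = x * (c *: y).
Proof.
congr pair => /=; first exact: mulrCA.
by rewrite !scalerDr amulZr !scalerA [c * x.1]mulrC.
Qed.

HB.instance Definition _ :=
  GRing.Lalgebra_isAlgebra.Build F L unitization_scaleAr.

HB.instance Definition _ := Algebra_isFalgebra.Build F L.

Definition unitization_incl (r : table_alg M) : L := (0, r).

Definition is_radical_of_unitization : Prop :=
  forall x : L,
    x \isn't a GRing.unit <-> exists r : table_alg M, x = unitization_incl r.

End Unitization.

(* The free associative algebra on the four letters x, y, x^T, y^T, numbered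
   0, 1, 2, 3 in this order. *)
Definition ncpoly (F : fieldType) : Type := {malg F[{fmonom 'I_4}]}.

Section Substitution.

Variables (F : fieldType) (n : nat).
Implicit Types A B : 'M[F]_n.+1.

Definition word_value A B (w : {fmonom 'I_4}) : 'M[F]_n.+1 :=
  \prod_(i <- (w : seq 'I_4)) tnth [tuple A; B; A^T; B^T] i.

Definition ncpoly_value A B (p : ncpoly F) : 'M[F]_n.+1 :=
  mmap (@scalar_mx F n.+1) (word_value A B) p.

Definition subst_mx (m : nat) (T : 'M[ncpoly F]_m) A B
    : 'M[F]_(\sum_(i < m) n.+1) :=
  \mxblock_(i < m, j < m) ncpoly_value A B (T i j).

Definition subst_table (m : nat) (T : 'I_3 -> 'M[ncpoly F]_m) A B (k : 'I_3)
    : 'M[F]_(\sum_(i < m) n.+1) :=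
  subst_mx (T k) A B.

Definition similar_pairs A B C D : Prop :=
  exists S : 'M[F]_n.+1,
    [/\ S \in unitmx, C = invmx S *m A *m S & D = invmx S *m B *m S].

End Substitution.

Definition local_wild (F : fieldType) : Prop :=
  exists (m : nat) (T : 'I_3 -> 'M[ncpoly F]_m), forall n : nat,
    (forall A B : 'M[F]_n.+1,
       is_radical_of_unitization (subst_table T A B) /\
       local_class (unitization (subst_table T A B))) /\
    (forall A B C D : 'M[F]_n.+1,
       similar_pairs A B C D <->
       falg_iso (unitization (subst_table T A B))
                (unitization (subst_table T C D))).

Definition lie_wild (F : fieldType) : Prop :=
  exists (m : nat) (T : 'I_3 -> 'M[ncpoly F]_m), forall n : nat,
    (forall A B : 'M[F]_n.+1, lie_class (table_alg (subst_table T A B))) /\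
    (forall A B C D : 'M[F]_n.+1,
       similar_pairs A B C D <->
       nonassoc_iso (table_alg (subst_table T A B))
                    (table_alg (subst_table T C D))).

(* Main.v *)
From HB Require Import structures.
Require Import Defs.
From mathcomp Require Import all_boot all_order all_algebra all_field.
From mathcomp Require Import monalg ring.

Set Implicit Arguments.
Unset Strict Implicit.
Unset Printing Implicit Defensive.

Import GRing.Theory.
Local Open Scope ring_scope.

(** Both classes are reduced to one problem on three bilinear forms.  When the
    products of [table_alg M] fill the whole span of e_0, e_1, e_2, an
    isomorphism from [table_alg M] to [table_alg M'] is the same as an
    invertible S and an invertible 3 x 3 matrix g with
    S M'_k S^T = \sum_l g_lk M_l for each k ([congruence_of_table_iso]), and
    isomorphisms of the unitizations restrict to isomorphisms of the radicals
    ([table_iso_of_unitization_iso]).  The substitution g of the three forms is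
    the whole difficulty: (A, B) has to be hidden in forms that admit no
    substitution but the scalar ones.

    The forms used are the coefficients in x, y, z of the off-diagonal matrix
    with blocks P and eps P^T, where P(x, y, z) = [x I + z A~ | y I + z B~] and
    eps = 1 (symmetric forms, commutative algebras) or eps = -1 (alternating
    forms, Lie algebras).  For z != 0 the left kernel of P(x, y, z) is the joint
    eigenspace of (A~, B~) for the eigenvalues - x / z and - y / z, and for z = 0
    it vanishes unless x = y = 0.  So P drops rank exactly at the joint
    eigenvalues of the pair, up to sign, seen as points of the projective plane.
    The pair is built so that these are four points (a, a^2, 1) of the moment
    curve, with eigenspaces of dimensions n, 2n, 3n, 4n.  As g preserves ranks,
    it maps each of the four points to a multiple of itself
    ([moment_point_of_rank]), and a linear map having four distinct points of the
    moment curve as eigenvectors is scalar ([moment_curve_rigid]).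

    Once g is scalar, the zero blocks of the first two forms force S to be
    block triangular, and its first diagonal block s satisfies s A~' = A~ s and
    s B~' = B~ s ([congruence_rigid]).  It remains to choose A~ and B~ so that
    their simultaneous similarity class knows that of (A, B).  The matrix A~ is
    diagonal, so s respects its eigenspaces; the off-diagonal part of B~ is a
    representation of a quiver on the path 0 -> 1 -> 2 -> 3, with identity maps
    along the path and the maps A : 0 -> 2 and B : 1 -> 3.  The identities make
    the four diagonal blocks of s equal, and the two remaining arrows say that
    this common block intertwines A and B ([similar_of_intertwiner]). *)

(** * Isomorphisms of table algebras and congruence of form triples *)

Section TableIsomorphism.

Variables (F : fieldType) (N : nat).
Implicit Types M : 'I_3 -> 'M[F]_N.

(** The products span the first summand.  Quantifying over predicates closed
    under linear combinations, rather than over subspaces, lets the property be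
    applied to a predicate as it stands, such as a vanishing condition. *)
Definition products_span M := forall P : table_alg M -> Prop,
  P 0 -> (forall c x y, P x -> P y -> P (c *: x + y)) ->
  (forall a b, P (amul a b)) -> forall e, P (e, 0).

(** Spanned by products, the first summand is preserved by every isomorphism,
    which acts on it by g and on the quotient, where the forms live, by S. *)
Lemma congruence_of_table_iso M M' : products_span M ->
    nonassoc_iso (table_alg M) (table_alg M') ->
  exists (S : 'M[F]_N) (g : 'M[F]_3), [/\ S \in unitmx, g \in unitmx &
    forall k, S *m M' k *m S^T = \sum_l g l k *: M l].
Proof.
move=> spanM; rewrite /nonassoc_iso /reverse_coercion => -[f [f_bij fM]].
have f_inj := bij_inj f_bij.
have f_e e : (f (e, 0)).2 = 0.
  apply: (spanM (fun x => (f x).2 = 0)) => [|c x y /= fx fy|a b].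
  - by rewrite linear0.
  - rewrite linearP -[LHS]/(c *: (f x).2 + (f y).2) fx fy.
    by rewrite scaler0 addr0.
  - by rewrite fM.
pose ge (e : 'rV[F]_3) : 'rV[F]_3 := (f (e, 0)).1.
have ge_lin : linear ge.
  move=> c e e'; rewrite /ge.
  have -> : (c *: e + e', 0) = c *: (e, 0) + (e', 0) :> table_alg M.
    by congr pair; rewrite /= scaler0 addr0.
  by rewrite linearP.
pose su (u : 'rV[F]_N) : 'rV[F]_N := (f (0, u)).2.
have su_lin : linear su.
  move=> c u u'; rewrite /su.
  have -> : (0, c *: u + u') = c *: (0, u) + (0, u') :> table_alg M.
    by congr pair; rewrite /= scaler0 addr0.
  by rewrite linearP.
pose geL : {linear 'rV[F]_3 -> 'rV[F]_3} :=
  HB.pack ge (GRing.isLinear.Build _ _ _ _ _ ge_lin).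
pose suL : {linear 'rV[F]_N -> 'rV[F]_N} :=
  HB.pack su (GRing.isLinear.Build _ _ _ _ _ su_lin).
pose g := lin1_mx geL; pose S := lin1_mx suL.
have gE e : f (e, 0) = (e *m g, 0).
  by rewrite [LHS]surjective_pairing f_e mul_rV_lin1.
have SE u : (f (0, u)).2 = u *m S by rewrite mul_rV_lin1.
have ug : g \in unitmx.
  rewrite -row_free_unit; apply: inj_row_free => e eg.
  have : f (e, 0) = f 0 by rewrite gE eg linear0.
  by move/f_inj => -[].
exists S, g; split=> //.
  (* A vector killed by S has the image of some (e, 0), hence vanishes. *)
  rewrite -row_free_unit; apply: inj_row_free => u uS.
  have : f (0, u) = f ((f (0, u)).1 *m invmx g, 0).
    by rewrite gE mulmxKV // [LHS]surjective_pairing SE uS.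
  by move/f_inj => -[].
move=> k; apply/matrixP => i j.
have entry p q (K : 'M[F]_(p, q)) a b :
    (delta_mx 0 a *m (K *m delta_mx b 0)) (0 : 'I_1) (0 : 'I_1) = K a b.
  by rewrite mulmxA -rowE -colE !mxE.
pose uij :=
  \row_l (delta_mx (0 : 'I_1) i *m M l *m (delta_mx (0 : 'I_1) j)^T) 0 0.
have key : (uij *m g, 0) = amul (f (0, delta_mx 0 i)) (f (0, delta_mx 0 j)).
  by rewrite -gE; apply: (fM (0, _) (0, _)).
move: key => /(congr1 (fun x : table_alg M' => x.1 0 k)) /=.
rewrite [RHS]mxE !SE mxE summxE trmx_mul trmx_delta !mulmxA.
rewrite -!(mulmxA (delta_mx 0 i)) entry => <-.
apply: eq_bigr => l _.
by rewrite [uij _ _]mxE trmx_delta -mulmxA entry mulrC !mxE.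
Qed.

Lemma table_iso_of_congruence M M' (S : 'M[F]_N) : S \in unitmx ->
    (forall k, S *m M' k *m S^T = M k) ->
  nonassoc_iso (table_alg M) (table_alg M').
Proof.
move=> uS SM; pose h (x : table_alg M) : table_alg M' := (x.1, x.2 *m S).
have h_lin : linear h.
  by move=> c x y; congr pair; rewrite /= mulmxDl -scalemxAl.
pose hL : {linear table_alg M -> table_alg M'} :=
  HB.pack h (GRing.isLinear.Build _ _ _ _ _ h_lin).
exists hL; split => /=.
  exists (fun x => (x.1, x.2 *m invmx S)) => -[e u];
    by rewrite /h /= ?mulmxK ?mulmxKV.
move=> x y.
transitivity ((\row_k (x.2 *m M k *m y.2^T) 0 0, 0 *m S) : table_alg M').
  by [].
rewrite mul0mx; congr pair.
by apply/rowP => k; rewrite mxE [RHS]mxE -SM trmx_mul !mulmxA.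
Qed.

Lemma span_commutators M : products_span M ->
  span_has_dim (@commutators F (table_alg M)) 3.
Proof.
move=> spanM; pose h (e : 'rV[F]_3) : table_alg M := (e, 0).
have h_lin : linear h.
  by move=> c x y; congr pair; rewrite /= scaler0 addr0.
pose hL : {linear 'rV[F]_3 -> table_alg M} :=
  HB.pack h (GRing.isLinear.Build _ _ _ _ _ h_lin).
exists (limg (linfun hL)); split; last first.
  rewrite limg_dim_eq ?dimvf ?dim_matrix //.
  apply/eqP; rewrite capfv; apply/lker0P => e e'.
  by rewrite !lfunE => -[].
split=> [v [a [b ->]]|W prodW].
  by rewrite -[amul a b]/(hL _) -(lfunE hL); apply: memv_img; apply: memvf.
apply/subvP => _ /memv_imgP[e _ ->]; rewrite lfunE /=.
apply: (spanM (fun x => x \in W)) => [|c x y xW yW|a b]; first exact: mem0v.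
  by rewrite memvD ?memvZ.
by apply: prodW; exists a, b.
Qed.

Lemma table_alg_lie_class M : products_span M ->
  (forall k (u : 'rV[F]_N), u *m M k *m u^T = 0) -> lie_class (table_alg M).
Proof.
move=> spanM alt; split; last exact: span_commutators.
  split=> [x|x y z]; last by rewrite !amul_nil3l !addr0.
  by congr pair; apply/rowP => k; rewrite mxE alt !mxE.
exact: amul_nil3l.
Qed.

End TableIsomorphism.

(** * The unitization: its units, radical and isomorphisms *)

Section Unitization.

Variables (F : fieldType) (N : nat).
Implicit Types M : 'I_3 -> 'M[F]_N.

Lemma unitization_mulE M (x y : unitization M) :
  x * y = (x.1 * y.1, (x.1 : F) *: y.2 + (y.1 : F) *: x.2 + amul x.2 y.2).
Proof. by []. Qed.

Lemma unitization_unitE M (x : unitization M) :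
  (x \is a GRing.unit) = (x.1 != 0 :> F).
Proof.
case: x => a r /=; apply/idP/idP => [/unitrP[y [_]]|a0].
  move/(congr1 (fun x : unitization M => x.1 : F)) => /= ay.
  by apply/eqP => a0; move: ay; rewrite a0 mul0r => /esym/eqP; rewrite oner_eq0.
(* The geometric series for the inverse of a + r stops, as r^3 = 0. *)
apply/unitrP; exists (a^-1, - a^-1 ^+ 2 *: r + a^-1 ^+ 3 *: amul r r).
have aa : a * a^-1 ^+ 2 = a^-1 by rewrite expr2 mulrA mulfV // mul1r.
have aaa : a * a^-1 ^+ 3 = a^-1 ^+ 2 by rewrite exprS mulrA mulfV // mul1r.
rewrite !unitization_mulE /= !scalerDr !scalerA mulrN aa aaa.
rewrite amulDl amulDr !amulZl !amulZr amul_nil3l amul_nil3r scaler0 addr0.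
rewrite mulVf // mulfV //; split; congr pair.
  by rewrite !addrA -scalerDl subrr scale0r add0r -scalerDl subrr scale0r.
by rewrite -addrA addrACA -!scalerDl addNr subrr !scale0r addr0.
Qed.

Lemma unitization_radical M : is_radical_of_unitization M.
Proof.
move=> x; rewrite unitization_unitE negbK; split=> [/eqP x0|[r ->]].
  by exists x.2; case: x x0 => a r /= ->.
exact: eqxx.
Qed.

Lemma nonunitE M (x : unitization M) : x \isn't a GRing.unit ->
  x = unitization_incl x.2.
Proof. by move=> /unitization_radical[r ->]. Qed.

Lemma incl_nonunit M (r : table_alg M) :
  unitization_incl r \isn't a GRing.unit.
Proof. by apply/unitization_radical; exists r. Qed.

Lemma inclM M (r s : table_alg M) :
  unitization_incl r * unitization_incl s = unitization_incl (amul r s).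
Proof.
by rewrite unitization_mulE /= mulr0 !scale0r !add0r.
Qed.

Fact incl_is_linear M : linear (@unitization_incl F N M).
Proof. by move=> c x y; congr pair; rewrite /= scaler0 addr0. Qed.

HB.instance Definition _ M := GRing.isLinear.Build F (table_alg M)
  (unitization M) _ (@unitization_incl F N M) (@incl_is_linear M).

Lemma unitization_local_class M : products_span M ->
  (forall k, (M k)^T = M k) -> local_class (unitization M).
Proof.
move=> spanM symM; have amulC (r s : table_alg M) : amul r s = amul s r.
  congr pair; apply/rowP => k; rewrite mxE [RHS]mxE.
  transitivity ((r.2 *m M k *m s.2^T)^T 0 0); first by rewrite [RHS]mxE.
  by rewrite !trmx_mul trmxK symM mulmxA.
split.
- move=> x y /nonunitE-> /nonunitE->; rewrite -raddfD; exact: incl_nonunit.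
- move=> x y; rewrite !unitization_mulE mulrC amulC; congr pair.
  by rewrite [X in X + _]addrC.
- split=> [v [a [b [c [/nonunitE-> /nonunitE-> /nonunitE-> ->]]]]|W _].
    by rewrite !inclM amul_nil3l linear0 mem0v.
  exact: sub0v.
have [U [[prodU minU] dimU]] := span_commutators spanM.
exists (linfun (@unitization_incl F N M) @: U)%VS; split; last first.
  rewrite limg_dim_eq //; apply/eqP; rewrite -subv0; apply/subvP => r.
  rewrite memv_cap memv_ker lfunE => /andP[_ /eqP[->]]; exact: mem0v.
split=> [v [a [b [/nonunitE-> /nonunitE-> ->]]]|W prodW].
  by rewrite inclM -lfunE memv_img //; apply: prodU; exists a.2, b.2.
have : (U <= linfun (@unitization_incl F N M) @^-1: W)%VS.
  apply: minU => _ [a [b ->]]; rewrite -memv_preim lfunE /= -inclM.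
  apply: prodW; exists (unitization_incl a), (unitization_incl b).
  by split=> //; exact: incl_nonunit.
move/subvP => UW; apply/subvP => _ /memv_imgP[r rU ->].
by rewrite memv_preim UW.
Qed.

(** The radical is the set of elements of cube zero, and so is preserved. *)
Lemma table_iso_of_unitization_iso M M' :
  falg_iso (unitization M) (unitization M') ->
  nonassoc_iso (table_alg M) (table_alg M').
Proof.
case=> f [h fK hK]; have f_inj := can_inj fK.
have f_incl r :
    f (unitization_incl r) = unitization_incl (f (unitization_incl r)).2.
  apply: nonunitE; rewrite unitization_unitE negbK.
  have : f (unitization_incl r) ^+ 3 = 0.
    by rewrite -rmorphXn /= !exprS expr0 mulr1 !inclM amul_nil3r raddf0.
  move/(congr1 (fun x : unitization M' => x.1)).
  by rewrite -[LHS]/((f (unitization_incl r)).1 ^+ 3) => /eqP; rewrite expf_eq0.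
pose h' (r : table_alg M') : table_alg M := (h (unitization_incl r)).2.
pose f' (r : table_alg M) : table_alg M' := (f (unitization_incl r)).2.
have f'_lin : linear f'.
  by move=> c x y; rewrite /f' !linearP.
pose f'L : {linear table_alg M -> table_alg M'} :=
  HB.pack f' (GRing.isLinear.Build _ _ _ _ _ f'_lin).
exists f'L; split=> [|x y]; last first.
  have : f (unitization_incl (amul x y))
         = unitization_incl (amul (f' x) (f' y)).
    by rewrite -!inclM rmorphM /= -!f_incl.
  by move/(congr1 (fun z : unitization M' => z.2)).
exists h' => [r|r]; rewrite /h' /= /f'; first by rewrite -f_incl fK.
have hE : h (unitization_incl r) = unitization_incl (h (unitization_incl r)).2.
  apply: nonunitE; apply: contra (incl_nonunit r) => u.
  by rewrite -[unitization_incl r]hK rmorph_unit.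
by rewrite -hE hK.
Qed.

Lemma unitization_iso_of_table_iso M M' :
  nonassoc_iso (table_alg M) (table_alg M') ->
  falg_iso (unitization M) (unitization M').
Proof.
case=> f [[h fK hK] fM].
pose f1 (x : unitization M) : unitization M' := (x.1, f x.2).
have f1_lin : linear f1 by move=> c x y; congr pair; rewrite /= linearP.
have f1_mul : monoid_morphism f1.
  split=> [|x y]; congr pair; rewrite /= ?raddf0 //.
  by rewrite !raddfD /= !linearZ /= fM.
pose f1L : {lrmorphism unitization M -> unitization M'} :=
  HB.pack f1 (GRing.isLinear.Build _ _ _ _ _ f1_lin)
    (GRing.isMonoidMorphism.Build _ _ _ f1_mul).
exists f1L; exists (fun x => (x.1, h x.2)) => -[a r];
  by congr pair; rewrite /= ?fK ?hK.
Qed.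

End Unitization.

(** * Pencils and the rigidity of their off-diagonal forms *)

Definition off_diag (F : fieldType) (eps : F) p q (P : 'M[F]_(p, q)) :
  'M[F]_(p + q) := block_mx 0 P (eps *: P^T) 0.

(** Its left kernel at (x, y, z), z != 0, is the joint eigenspace of A and B for
    the eigenvalues - x / z and - y / z. *)
Definition pencil (F : fieldType) N (A B : 'M[F]_N) (x y z : F) :
  'M[F]_(N, N + N) := row_mx (x%:M + z *: A) (y%:M + z *: B).

Section Rigidity.

Variable F : fieldType.

Lemma rank_off_diag (eps : F) p q (P : 'M[F]_(p, q)) :
  eps != 0 -> \rank (off_diag eps P) = (\rank P).*2.
Proof.
move=> eps0; pose swap : 'M[F]_(p + q, q + p) := block_mx 0 1%:M 1%:M 0.
have free_swap : row_free swap.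
  apply/row_freeP; exists (block_mx 0 1%:M 1%:M 0).
  rewrite mulmx_block !(mul0mx, mulmx0, mul1mx, addr0, add0r).
  by rewrite -scalar_mx_block.
rewrite -(mxrankMfree _ free_swap) mulmx_block.
rewrite !(mul0mx, mulmx0, mulmx1, addr0, add0r) rank_diag_block_mx.
by rewrite (eqmx_scale _ eps0) mxrank_tr addnn.
Qed.

Lemma pencil_scale N (A B : 'M[F]_N) c x y z :
  pencil A B (c * x) (c * y) (c * z) = c *: pencil A B x y z.
Proof.
by rewrite /pencil scale_row_mx !scalerDr !scale_scalar_mx !scalerA.
Qed.

Lemma off_diagZ (eps c : F) p q (P : 'M[F]_(p, q)) :
  off_diag eps (c *: P) = c *: off_diag eps P.
Proof.
by rewrite /off_diag scale_block_mx !scaler0 linearZ /= !scalerA mulrC.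
Qed.

Lemma pencil100 N (A B : 'M[F]_N) : pencil A B 1 0 0 = row_mx 1%:M 0.
Proof. by rewrite /pencil !scale0r !addr0 raddf0. Qed.

Lemma pencil010 N (A B : 'M[F]_N) : pencil A B 0 1 0 = row_mx 0 1%:M.
Proof. by rewrite /pencil !scale0r !addr0 raddf0. Qed.

Lemma pencil001 N (A B : 'M[F]_N) : pencil A B 0 0 1 = row_mx A B.
Proof. by rewrite /pencil !scale1r !raddf0 !add0r. Qed.

(** At (1, 0, 0) and (0, 1, 0) the forms do not involve A and B.  Comparing
    S M = lam M S^-T at these two points makes the lower left block of S vanish
    and its lower right block equal to diag(w11, w11); the upper right block of
    the congruence then reads s P'(x, y, z) diag(w11, w11)^T = lam P(x, y, z),
    so that w11^T is lam s^-1 and s intertwines. *)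
Lemma congruence_rigid N (eps lam : F) (A B A' B' : 'M[F]_N)
    (S : 'M[F]_(N + (N + N))) :
  eps != 0 -> lam != 0 -> S \in unitmx ->
  (forall x y z, S *m off_diag eps (pencil A' B' x y z) *m S^T
               = lam *: off_diag eps (pencil A B x y z)) ->
  exists s : 'M[F]_N, [/\ s \in unitmx, s *m A' = A *m s & s *m B' = B *m s].
Proof.
move=> eps0 lam0 uS congS; pose R := invmx S^T.
have congR x y z : S *m off_diag eps (pencil A' B' x y z)
                 = lam *: off_diag eps (pencil A B x y z) *m R.
  by rewrite -congS mulmxK ?unitmx_tr.
have h1 := congR 1 0 0; have h2 := congR 0 1 0.
move: h1 h2 congS; rewrite !(pencil100, pencil010) -!off_diagZ.
rewrite -[S]submxK -[R]submxK /off_diag; move: (ulsubmx _) (ursubmx _) => s u.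
move: (dlsubmx _) (drsubmx _) => v w.
rewrite -[v]vsubmxK -[w]submxK.
move: (usubmx _) (dsubmx _) => v1 v2.
move: (ulsubmx _) (ursubmx _) (dlsubmx _) (drsubmx _) => w11 w12 w21 w22.
move: (ulsubmx R) (ursubmx R) (dlsubmx R) (drsubmx R) => r11 r12 r21 r22.
rewrite !mulmx_block !(mul0mx, mulmx0, addr0, add0r).
rewrite !scale_row_mx !scaler0 !tr_row_mx !trmx0.
rewrite -!scalemxAr -!scalemxAl !mul_block_col !mul_col_row !mul_mx_row.
rewrite !linearZ /= !trmx1 !mul_col_mx !(mulmx0, mulmx1, mul0mx, addr0, add0r).
rewrite !scale_col_mx !scaler0 => /eq_block_mx[_ _ /eq_col_mx[w11E w21E]].
rewrite {1}/block_mx => /eq_col_mx[_] /eqP.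
rewrite row_mx_eq0 => /andP[/eqP v2E _].
move=> /eq_block_mx[_ _ /eq_col_mx[w12E w22E]].
rewrite {1}/block_mx => /eq_col_mx[] /eqP.
rewrite row_mx_eq0 => /andP[_ /eqP v1E] _.
have {w11E} w22E : w22 = w11 by apply: (scalerI eps0); rewrite w22E w11E.
have {}w21E : w21 = 0 by apply: (scalerI eps0); rewrite w21E scaler0.
have {}w12E : w12 = 0 by apply: (scalerI eps0); rewrite w12E scaler0.
rewrite {}v1E {}v2E {}w12E {}w21E {}w22E => congS.
have {congS} urE x y z : s *m pencil A' B' x y z *m (block_mx w11 0 0 w11)^T
                         = lam *: pencil A B x y z.
  have := congS x y z; rewrite !tr_block_mx !mulmx_block scale_block_mx.
  rewrite !(mul0mx, mulmx0, addr0, add0r) col_mx0 trmx0 mulmx0 add0r.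
  by case/eq_block_mx.
have := urE 0 0 1; have := urE 1 0 0; rewrite !pencil100 !pencil001.
rewrite tr_block_mx !trmx0 !mul_mx_row !mul_row_block.
rewrite !(mul0mx, mulmx0, mulmx1, addr0, add0r).
rewrite !scale_row_mx scaler0 scalemx1 => /eq_row_mx[sw _] /eq_row_mx[swA swB].
have sV : s *m (lam^-1 *: w11^T) = 1%:M.
  by rewrite -scalemxAr sw scale_scalar_mx mulVf.
have ws : (lam^-1 *: w11^T) *m s = 1%:M by apply: mulmx1C.
have [us _] := mulmx1_unit sV.
have fin (X Y : 'M[F]_N) : s *m X *m w11^T = lam *: Y -> s *m X = Y *m s.
  move=> E; rewrite -[LHS]mulmx1 -ws mulmxA -scalemxAr E scalerA mulVf //.
  by rewrite scale1r.
by exists s; split=> //; apply: fin.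
Qed.

Lemma congruence_of_intertwiner N (eps : F) (A B A' B' s : 'M[F]_N) :
    s \in unitmx -> s *m A' = A *m s -> s *m B' = B *m s ->
  exists2 S : 'M[F]_(N + (N + N)), S \in unitmx &
    forall x y z, S *m off_diag eps (pencil A' B' x y z) *m S^T
                = off_diag eps (pencil A B x y z).
Proof.
move=> us sA sB; pose r := (invmx s)^T.
have sr : s *m r^T = 1%:M by rewrite trmxK mulmxV.
pose w := block_mx r 0 0 r.
exists (block_mx s 0 0 w) => [|x y z].
  have : block_mx s 0 0 w
         *m block_mx (invmx s) 0 0 (block_mx s^T 0 0 s^T) = 1%:M.
    rewrite !mulmx_block !(mul0mx, mulmx0, addr0, add0r) mulmxV //.
    by rewrite -trmx_mul mulmxV // trmx1 -!scalar_mx_block.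
  by case/mulmx1_unit.
have sPw : s *m pencil A' B' x y z *m w^T = pencil A B x y z.
  rewrite tr_block_mx !trmx0 mul_mx_row mul_row_block !mulmx0 addr0 add0r.
  have conj c d (K K' : 'M[F]_N) : s *m K' = K *m s ->
      s *m (c%:M + d *: K') *m r^T = c%:M + d *: K.
    move=> sK; rewrite mulmxDr mulmxDl mul_mx_scalar -scalemxAr -!scalemxAl.
    by rewrite sK -mulmxA !sr mulmx1 scalemx1.
  by rewrite (conj _ _ _ _ sA) (conj _ _ _ _ sB).
rewrite tr_block_mx !trmx0 !mulmx_block !(mul0mx, mulmx0, addr0, add0r).
rewrite sPw -scalemxAr -scalemxAl; congr (block_mx _ _ (_ *: _) _).
by rewrite -sPw !trmx_mul trmxK mulmxA.
Qed.

End Rigidity.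

(** * Linear maps fixing four points of the moment curve *)

Lemma sum3E (V : nmodType) (f : 'I_3 -> V) :
  \sum_k f k = f (inord 0) + f (inord 1) + f (inord 2).
Proof.
rewrite !big_ord_recl big_ord0 addr0 addrA.
by congr (f _ + f _ + f _); apply: val_inj; rewrite /= inordK.
Qed.

Section MomentCurve.

Variables (F : fieldType) (alpha : seq F).
Hypotheses (alpha_uniq : uniq alpha) (alpha_size : size alpha = 4%N).

Definition moment_point (a : F) : 'cV[F]_3 := \col_k [:: a; a ^+ 2; 1]`_k.

Lemma cubic_four_roots (c : seq F) :
    size c = 4%N -> (forall a, a \in alpha -> (Poly c).[a] = 0) ->
  forall i, c`_i = 0.
Proof.
move=> c4 c0 i; have P0 : Poly c = 0.
  apply: (roots_geq_poly_eq0 (rs := alpha)) => //.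
    by apply/allP => a a_alpha; apply/rootP/c0.
  by rewrite alpha_size -c4 size_Poly.
by rewrite -coef_Poly P0 coef0.
Qed.

(** Let q_i(a) be the i-th coordinate of g applied to (a, a^2, 1), a quadratic
    polynomial.  The cubics q_0 - X q_2 and q_1 - X q_0 vanish at the four
    points, hence identically, so q_0 = X q_2 and q_1 = X^2 q_2; as q_1 has
    degree at most 2, q_2 is a constant. *)
Lemma moment_curve_rigid (g : 'M[F]_3) :
    (forall a, a \in alpha ->
       exists lam, g *m moment_point a = lam *: moment_point a) ->
  exists lam, g = lam%:M.
Proof.
move=> geig; pose g_ i j : F := g (inord i) (inord j).
have gE a : a \in alpha -> exists lam, forall i, (i < 3)%N ->
    g_ i 0%N * a + g_ i 1%N * a ^+ 2 + g_ i 2%N = lam * [:: a; a ^+ 2; 1]`_i.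
  move=> /geig[lam gl]; exists lam => i i3.
  have := congr1 (fun M : 'cV_3 => M (inord i) 0) gl.
  rewrite !mxE inordK // => <-.
  by rewrite sum3E !mxE !inordK //= mulr1.
(* The coefficients of q_0 - X q_2, then those of q_1 - X q_0. *)
have c1 : forall i, [:: g_ 0%N 2%N; g_ 0%N 0%N - g_ 2%N 2%N;
                        g_ 0%N 1%N - g_ 2%N 0%N; - g_ 2%N 1%N]`_i = 0.
  apply: cubic_four_roots => // a /gE[lam gl].
  have := gl 0%N isT; have := gl 2%N isT.
  rewrite horner_Poly /= mulr1 => <- e0.
  move/eqP: e0; rewrite -subr_eq0 => /eqP e; rewrite -[RHS]e; ring.
have c2 : forall i, [:: g_ 1%N 2%N; g_ 1%N 0%N - g_ 0%N 2%N;
                        g_ 1%N 1%N - g_ 0%N 0%N; - g_ 0%N 1%N]`_i = 0.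
  apply: cubic_four_roots => // a /gE[lam gl].
  have := gl 0%N isT; have := gl 1%N isT.
  rewrite horner_Poly /= => e1 e0.
  have : lam * a ^+ 2 = (lam * a) * a by ring.
  rewrite -e0 -e1 => /eqP; rewrite -subr_eq0 => /eqP e; rewrite -[RHS]e; ring.
have [g02 g00 g01 g21] := And4 (c1 0%N) (c1 1%N) (c1 2%N) (c1 3%N).
have [g12 g10 g11 g01'] := And4 (c2 0%N) (c2 1%N) (c2 2%N) (c2 3%N).
move: g02 g00 g01 g21 g12 g10 g11 g01' => /= g02 /subr0_eq g00 /subr0_eq g01.
move=> /eqP; rewrite oppr_eq0 => /eqP g21 g12 /subr0_eq g10 /subr0_eq g11 /eqP.
rewrite oppr_eq0 => /eqP g01'.
exists (g_ 0%N 0%N); apply/matrixP => i j; rewrite !mxE.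
have -> : g i j = g_ i j by rewrite /g_ !inord_val.
rewrite -val_eqE; case: i j => [[|[|[|//]]] ?] [[|[|[|//]]] ?] /=;
  by rewrite ?mulr1n ?mulr0n ?g10 -?g01.
Qed.

End MomentCurve.

(** * A pair of block matrices with four joint eigenvalues *)

(** Which of the four joint eigenvalues each of the thirteen diagonal blocks
    carries.  The first four slots are the vertices of the quiver.  The other
    nine, on which no arrow acts, only enlarge the eigenspaces: with them, the
    part of label l killed by all arrows consists of l + 1 blocks. *)
Definition slot_label : nat -> nat :=
  nth 0%N [:: 0; 1; 2; 3; 0; 1; 1; 2; 2; 2; 3; 3; 3]%N.

(** A block of the matrices is c, c A or c B: a coefficient and possibly a
    letter, [Some false] for A and [Some true] for B.  The same data serve for
    the noncommutative polynomials and for their values. *)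
Definition entry F := (F * option bool)%type.

Definition diag_entry (F : fieldType) (c : F) (i j : nat) : entry F :=
  (if i == j then c else 0, None).

(** With the identity along the path 0 -> 1 -> 2 -> 3, the maps on the two
    remaining arrows are determined up to simultaneous similarity. *)
Definition arrow (F : fieldType) (i j : nat) : entry F :=
  match i, j with
  | 0, 1 | 1, 2 | 2, 3 => (1, None)
  | 0, 2 => (1, Some false)
  | 1, 3 => (1, Some true)
  | _, _ => (0, None)
  end.

Definition entryA (F : fieldType) (alpha : seq F) (i j : nat) : entry F :=
  diag_entry (- alpha`_(slot_label i)) i j.

Definition entryB (F : fieldType) (alpha : seq F) (i j : nat) : entry F :=
  if i == j then diag_entry (- alpha`_(slot_label i) ^+ 2) i j else arrow F i j.

Definition entry_mx (F : fieldType) n (X Y : 'M[F]_n) (e : entry F) : 'M[F]_n :=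
  e.1 *: (if e.2 is Some b then if b then Y else X else 1%:M).

Definition blocks (F : fieldType) n (X Y : 'M[F]_n) p
    (e : nat -> nat -> entry F) : 'M[F]_(\sum_(i < p) n) :=
  \mxblock_(i < p, j < p) entry_mx X Y (e i j).

Section Blocks.

Variables (F : fieldType) (alpha : seq F) (n : nat).
Hypotheses (alpha_uniq : uniq alpha) (alpha_size : size alpha = 4%N).
Implicit Types X Y : 'M[F]_n.+1.

Local Notation N := (\sum_(i < 13) n.+1)%N.
Local Notation bA X Y := (blocks X Y 13 (entryA alpha)).
Local Notation bB X Y := (blocks X Y 13 (entryB alpha)).

Lemma submxrow_mul_blocks r (K : 'M[F]_(r, N)) X Y e (j : 'I_13) :
  submxrow (K *m blocks X Y 13 e) j =
  \sum_i (submxrow K i *m entry_mx X Y (e i j)).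
Proof.
by rewrite -{1}[K]submxrowK mul_mxrow_mxblock mxrowK.
Qed.

Lemma submxrowZ r p (p_ : 'I_p -> nat) c (K : 'M[F]_(r, \sum_i p_ i)) j :
  submxrow (c *: K) j = c *: submxrow K j.
Proof. by apply/matrixP=> a b; rewrite !mxE. Qed.

Lemma entry_diagE X Y c i j :
  entry_mx X Y (diag_entry c i j) = (if i == j then c else 0)%:M.
Proof. by rewrite /entry_mx /= scalemx1. Qed.

Lemma submxrow_mulA r (K : 'M[F]_(r, N)) X Y x z (j : 'I_13) :
  submxrow (K *m (x%:M + z *: bA X Y)) j =
  (x - z * alpha`_(slot_label j)) *: submxrow K j.
Proof.
rewrite mulmxDr mul_mx_scalar -scalemxAr submxrowD !submxrowZ.
rewrite submxrow_mul_blocks (bigD1 j) //= big1 => [|i /negPf ij].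
  rewrite entry_diagE eqxx mul_mx_scalar addr0 scalerA mulrN.
  by rewrite scalerBl scaleNr.
by rewrite entry_diagE val_eqE ij raddf0 mulmx0.
Qed.

Lemma entry_arrow_diag X Y i : entry_mx X Y (arrow F i i) = 0.
Proof. by case: i => [|[|[|i]]]; rewrite /entry_mx scale0r. Qed.

Lemma submxrow_mulB r (K : 'M[F]_(r, N)) X Y y z (j : 'I_13) :
  submxrow (K *m (y%:M + z *: bB X Y)) j =
  (y - z * alpha`_(slot_label j) ^+ 2) *: submxrow K j
  + z *: \sum_i (submxrow K i *m entry_mx X Y (arrow F i j)).
Proof.
rewrite mulmxDr mul_mx_scalar -scalemxAr submxrowD !submxrowZ.
rewrite submxrow_mul_blocks (bigD1 j) //= [in RHS](bigD1 j) //=.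
rewrite entry_arrow_diag mulmx0 add0r /entryB eqxx entry_diagE eqxx.
rewrite mul_mx_scalar scalerDr scalerA mulrN scalerBl addrA -scaleNr.
by congr (_ + z *: _); apply: eq_bigr => i /negPf ij; rewrite val_eqE ij.
Qed.

(** The slots of label l from which no arrow starts; slot 3, the end of the
    path, is one of them. *)
Definition idle (l i : nat) : bool := (slot_label i == l) && (3 <= i)%N.

Lemma arrow_row0 (i j : nat) : (3 <= i)%N -> arrow F i j = (0, None).
Proof. by case: i => [|[|[|i]]]. Qed.

Lemma arrow_col0 (i j : nat) : (4 <= j)%N -> arrow F i j = (0, None).
Proof. by case: j => [|[|[|[|j]]]] //; case: i => [|[|[|i]]]. Qed.

Lemma slot_label_active (i : 'I_13) l :
  (l < 4)%N -> (i < 4)%N -> slot_label i = l -> i = l :> nat.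
Proof. by case: i => [[|[|[|[|i]]]] ?]. Qed.

Lemma slot_label_lt4 (i : 'I_13) : (slot_label i < 4)%N.
Proof.
by case: i => i; do 13 (case: i => [|i] //).
Qed.

(** No slot of label l other than slot l is the source of an arrow. *)
Lemma sum_arrow_slot r (K : 'M[F]_(r, N)) X Y l (j i0 : 'I_13) :
    (l < 4)%N -> i0 = l :> nat ->
    (forall i : 'I_13, slot_label i != l -> submxrow K i = 0) ->
  \sum_i (submxrow K i *m entry_mx X Y (arrow F i j)) =
  submxrow K i0 *m entry_mx X Y (arrow F l j).
Proof.
move=> l4 i0E K0; rewrite (bigD1 i0) //= big1 ?addr0 ?i0E // => i ii0.
case: (eqVneq (slot_label i) l) => [iE|/K0->]; last by rewrite mul0mx.
rewrite arrow_row0 ?/entry_mx ?scale0r ?mulmx0 //.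
rewrite ltnNge; apply: contra ii0 => i2; rewrite -val_eqE /= i0E.
by rewrite (slot_label_active l4 _ iE) // ltnW.
Qed.

Lemma alpha_nth_eq (i j : nat) : (i < 4)%N -> (j < 4)%N ->
  (alpha`_i == alpha`_j) = (i == j).
Proof. by move=> i4 j4; rewrite nth_uniq ?alpha_size. Qed.

(** The first half of the pencil confines the kernel to the slots of label l.
    Of these only slot l, when l < 3, is the source of an arrow, and the identity
    arrow into slot l + 1, whose label is different, kills its component. *)
Lemma pencil_kernel_moment r (K : 'M[F]_(r, N)) X Y l : (l < 4)%N ->
  K *m pencil (bA X Y) (bB X Y) alpha`_l (alpha`_l ^+ 2) 1 = 0 <->
  forall i : 'I_13, ~~ idle l i -> submxrow K i = 0.
Proof.
move=> l4; have l13 : (l < 13)%N by apply: leq_trans l4 _.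
pose l' := Ordinal l13.
rewrite mul_mx_row; split=> [/eqP|K0].
  rewrite row_mx_eq0 => /andP[/eqP KA /eqP KB] i.
  have Klab (k : 'I_13) : slot_label k != l -> submxrow K k = 0.
    move=> kl; have := congr1 (fun M => submxrow M k) KA.
    rewrite submxrow_mulA submxrow0 => /eqP.
    rewrite scaler_eq0 mul1r subr_eq0 eq_sym alpha_nth_eq ?slot_label_lt4 //.
    by rewrite (negPf kl) => /eqP.
  rewrite negb_and -ltnNge => /orP[/Klab//|i3].
  have [iE|/Klab//] := eqVneq (slot_label i) l.
  have il : i = l :> nat by apply: slot_label_active => //; apply: ltnW.
  have i4 : (i.+1 < 13)%N by apply: (@leq_trans 4).
  have := congr1 (fun M => submxrow M (Ordinal i4)) KB.
  rewrite submxrow_mulB submxrow0 (@sum_arrow_slot _ _ _ _ l _ i) //.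
  rewrite [submxrow K (Ordinal _)]Klab; last first.
    by rewrite /= -il; case: (nat_of_ord i) i3 => [|[|[|?]]].
  rewrite scaler0 add0r scale1r -il.
  have -> : entry_mx X Y (arrow F i (Ordinal i4)) = 1%:M.
    rewrite /=; case: (nat_of_ord i) i3 => [|[|[|?]]] // _;
      by rewrite /entry_mx scale1r.
  by rewrite mulmx1.
have Klab (k : 'I_13) : slot_label k != l -> submxrow K k = 0.
  by move=> kl; apply: K0; rewrite /idle (negPf kl).
apply/eqP; rewrite row_mx_eq0; apply/andP; split; apply/eqP/mxrowP=> j.
  rewrite submxrow_mulA submxrow0 mul1r.
  case: (eqVneq (slot_label j) l) => [->|/Klab->]; last by rewrite scaler0.
  by rewrite subrr scale0r.
rewrite submxrow_mulB submxrow0 (@sum_arrow_slot _ _ _ _ l _ l') // !mul1r.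
case: (ltnP l 3) => l3.
  rewrite [submxrow K l']K0 /idle ?mul0mx ?scaler0 ?addr0 /=; last first.
    by rewrite negb_and -ltnNge l3 orbT.
  case: (eqVneq (slot_label j) l) => [->|/Klab->]; last by rewrite scaler0.
  by rewrite subrr scale0r.
rewrite arrow_row0 // /entry_mx scale0r mulmx0 scaler0 addr0.
case: (eqVneq (slot_label j) l) => [->|/Klab->]; last by rewrite scaler0.
by rewrite subrr scale0r.
Qed.

Lemma rank_pencil_moment X Y l : (l < 4)%N ->
  (\rank (pencil (bA X Y) (bB X Y) alpha`_l (alpha`_l ^+ 2) 1%R)
   + l.+1 * n.+1 = N)%N.
Proof.
move=> l4; set P := pencil _ _ _ _ _.
pose D : 'M[F]_N :=
  \mxdiag_(i < 13) (if idle l i then 1%:M else 0 : 'M[F]_n.+1).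
have rD : \rank D = (l.+1 * n.+1)%N.
  rewrite rank_mxdiag.
  rewrite (eq_bigr (fun i : 'I_13 => idle l i * n.+1)%N) => [|i _]; last first.
    by case: ifP; rewrite ?mxrank1 ?mul1n ?mxrank0.
  rewrite -big_distrl /=; congr (_ * _)%N.
  by move: l4; rewrite !big_ord_recl big_ord0; move: l {P D} => [|[|[|[|]]]].
(* D is idempotent, so its row space is the set of its fixed vectors. *)
have kerD : (kermx P == D)%MS.
  apply/rV_eqP=> u; rewrite sub_kermx.
  have -> : (u <= D)%MS = (u *m D == u).
    apply/idP/eqP=> [/submxP[v ->]|<-]; last exact: submxMl.
    rewrite -mulmxA; congr (_ *m _); rewrite mul_mxdiag_mxblock.
    apply: eq_mxblock => i j; case: eqP => [E|_]; last by rewrite mulmx0.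
    by case: _ / E; case: ifP => ?; rewrite ?conform_mx_id ?mul1mx ?mul0mx.
  apply/eqP/eqP => [/(pencil_kernel_moment _ _ _ l4) u0|uD].
    rewrite -[u]submxrowK mul_mxrow_mxdiag; apply: eq_mxrow => i.
    by case: ifP => [_|/negbT/u0->]; rewrite ?mulmx1 ?mul0mx.
  apply/(pencil_kernel_moment _ _ _ l4) => i /negPf il.
  by rewrite -uD -[u]submxrowK mul_mxrow_mxdiag mxrowK il mulmx0.
by rewrite -rD -(eqmxP kerD) mxrank_ker subnKC // rank_leq_row.
Qed.

(** For z = 0 the pencil is [x I | y I].  Otherwise the kernel lives, as above,
    on the slots of a single label l, with no component on slot l unless l = 3.
    The arrows thus vanish on it, so the second half of the pencil multiplies it
    by y - z alpha_l^2, which is not 0. *)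
Lemma rank_pencil_generic X Y (x y z : F) :
    [|| x != 0, y != 0 | z != 0] ->
    (forall l, (l < 4)%N -> (x, y) != (z * alpha`_l, z * alpha`_l ^+ 2)) ->
  \rank (pencil (bA X Y) (bB X Y) x y z) = N.
Proof.
move=> xyz0 off; apply/eqP; rewrite -/(row_free _) -kermx_eq0; apply/eqP.
set P := pencil _ _ _ _ _; have := mulmx_ker P; move: (kermx P) => K /eqP.
rewrite mul_mx_row row_mx_eq0 => /andP[/eqP KA /eqP KB].
have eA (j : 'I_13) := congr1 (fun M => submxrow M j) KA.
have eB (j : 'I_13) := congr1 (fun M => submxrow M j) KB.
have {}eA (j : 'I_13) : x = z * alpha`_(slot_label j) \/ submxrow K j = 0.
  have := eA j; rewrite submxrow_mulA submxrow0 => /eqP.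
  by rewrite scaler_eq0 subr_eq0 => /orP[]/eqP; [left|right].
apply/mxrowP => j; rewrite submxrow0.
have [xE|//] := eA j.
have [z0|z0] := eqVneq z 0.
  have := eB j; rewrite submxrow_mulB submxrow0 z0 scale0r mul0r subr0 addr0.
  move/eqP; rewrite scaler_eq0 => /orP[/eqP y0|/eqP//].
  by move: xyz0; rewrite xE y0 z0 mul0r eqxx.
pose l := slot_label j; have l4 : (l < 4)%N := slot_label_lt4 j.
have Klab (k : 'I_13) : slot_label k != l -> submxrow K k = 0.
  move=> kl; case: (eA k) => //; rewrite xE => /(mulfI z0)/eqP.
  by rewrite alpha_nth_eq ?slot_label_lt4 // eq_sym (negPf kl).
have l13 : (l < 13)%N by apply: leq_trans l4 _.
have y0 : y - z * alpha`_l ^+ 2 != 0.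
  by rewrite subr_eq0; apply: contra (off _ l4) => /eqP->; rewrite xE.
have Kl : (l < 3)%N -> submxrow K (Ordinal l13) = 0.
  move=> l3; have l4' : (l.+1 < 13)%N by apply: (@leq_trans 4).
  have := eB (Ordinal l4').
  rewrite submxrow_mulB submxrow0.
  rewrite (@sum_arrow_slot _ _ _ _ l _ (Ordinal l13)) //.
  rewrite [submxrow K (Ordinal l4')]Klab; last first.
    by rewrite /=; case: (l) l3 => [|[|[|?]]].
  rewrite scaler0 add0r => /eqP; rewrite scaler_eq0 (negPf z0) => /eqP.
  have -> : entry_mx X Y (arrow F l (Ordinal l4')) = 1%:M.
    rewrite /=; case: (l) l3 => [|[|[|?]]] // _;
      by rewrite /entry_mx /= scale1r.
  by rewrite mulmx1.
have := eB j; rewrite submxrow_mulB submxrow0.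
rewrite (@sum_arrow_slot _ _ _ _ l _ (Ordinal l13)) //.
have -> : submxrow K (Ordinal l13) *m entry_mx X Y (arrow F l j) = 0.
  case: (ltnP l 3) => l3; first by rewrite Kl // mul0mx.
  by rewrite arrow_row0 // /entry_mx scale0r mulmx0.
by rewrite scaler0 addr0 => /eqP; rewrite scaler_eq0 (negPf y0) => /eqP.
Qed.

End Blocks.

(** * Recovering the pair from the block matrices *)

Section Intertwiner.

Variables (F : fieldType) (alpha : seq F) (n : nat).
Hypotheses (alpha_uniq : uniq alpha) (alpha_size : size alpha = 4%N).
Implicit Types X Y : 'M[F]_n.+1.

Local Notation N := (\sum_(i < 13) n.+1)%N.
Local Notation bA X Y := (blocks X Y 13 (entryA alpha)).
Local Notation bB X Y := (blocks X Y 13 (entryB alpha)).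

Lemma submxblock_mul p (K L : 'M[F]_(\sum_(i < p) n.+1)) i j :
  submxblock (K *m L) i j = \sum_k submxblock K i k *m submxblock L k j.
Proof.
by rewrite -{1}[K]submxblockK -{1}[L]submxblockK mul_mxblock mxblockK.
Qed.

Lemma entryB_split X Y (i j : 'I_13) :
  entry_mx X Y (entryB alpha i j) =
  (if i == j then - alpha`_(slot_label i) ^+ 2 else 0)%:M
  + entry_mx X Y (arrow F i j).
Proof.
rewrite /entryB val_eqE; case: eqP => [->|_].
  by rewrite entry_arrow_diag entry_diagE eqxx addr0.
by rewrite raddf0 add0r.
Qed.

Lemma sum_mulmx_if (s : 'I_13 -> 'M[F]_n.+1) (c : 'I_13 -> F) j :
  \sum_k s k *m (if k == j then c k else 0)%:M = c j *: s j.
Proof.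
rewrite (bigD1 j) //= eqxx big1 ?addr0 ?mul_mx_scalar // => k /negPf->.
by rewrite raddf0 mulmx0.
Qed.

Lemma sum_if_mulmx (s : 'I_13 -> 'M[F]_n.+1) (c : F) i :
  \sum_k (if i == k then c else 0)%:M *m s k = c *: s i.
Proof.
rewrite (bigD1 i) //= eqxx big1 ?addr0 ?mul_scalar_mx // => k.
by rewrite eq_sym => /negPf->; rewrite raddf0 mul0mx.
Qed.

(** Commuting with the diagonal A~ makes s block diagonal for the labels, hence
    compatible with the diagonal part of B~ as well: s intertwines the arrows
    alone.  Reading this at the arrows (0, 1), (1, 2), (2, 3) gives
    s_00 = s_11 = s_22 = s_33, and at (0, 2) and (1, 3) that s_00 intertwines
    the pairs.  The equation at (4, 1) gives s_40 = 0; slot 4 being the only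
    other slot of label 0, the column of s through slot 0 is concentrated in
    s_00, which is therefore invertible. *)
Lemma similar_of_intertwiner X Y X' Y' (s : 'M[F]_N) :
    s \in unitmx ->
    s *m bA X' Y' = bA X Y *m s -> s *m bB X' Y' = bB X Y *m s ->
  similar_pairs X Y X' Y'.
Proof.
move=> us sA sB.
have slab (i j : 'I_13) : slot_label i != slot_label j -> submxblock s i j = 0.
  move=> ij; have := congr1 (fun M => submxblock M i j) sA.
  rewrite !submxblock_mul.
  under eq_bigr do rewrite mxblockK entry_diagE val_eqE.
  under [in RHS]eq_bigr do rewrite mxblockK entry_diagE val_eqE.
  rewrite sum_mulmx_if sum_if_mulmx => /eqP.
  rewrite -subr_eq0 -scalerBl scaler_eq0 opprK addrC subr_eq0.
  rewrite alpha_nth_eq ?slot_label_lt4 //.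
  by rewrite (negPf ij) => /eqP.
have sarr (i j : 'I_13) :
    \sum_(k < 13) submxblock s i k *m entry_mx X' Y' (arrow F k j)
  = \sum_(k < 13) entry_mx X Y (arrow F i k) *m submxblock s k j.
  have := congr1 (fun M => submxblock M i j) sB.
  rewrite !submxblock_mul.
  under eq_bigr do rewrite mxblockK entryB_split mulmxDr.
  under [in RHS]eq_bigr do rewrite mxblockK entryB_split mulmxDl.
  rewrite !big_split /= sum_mulmx_if sum_if_mulmx.
  have [->|/slab->] := eqVneq (slot_label i) (slot_label j); first exact: addrI.
  by rewrite !scaler0 !add0r.
pose s_ i j : 'M[F]_n.+1 := submxblock s (inord i) (inord j).
have slab_ i j : (i < 13)%N -> (j < 13)%N ->
    slot_label i != slot_label j -> s_ i j = 0.
  by move=> i13 j13 ij; apply: slab; rewrite !inordK.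
have sarr_ i j : (i < 13)%N -> (j < 13)%N ->
    \sum_(k <- iota 0 13) s_ i k *m entry_mx X' Y' (arrow F k j)
  = \sum_(k <- iota 0 13) entry_mx X Y (arrow F i k) *m s_ k j.
  move=> i13 j13; have := sarr (inord i) (inord j); rewrite !inordK //.
  rewrite -[iota 0 13]/(index_iota 0 13) !big_mkord => sarr_ij.
  under eq_bigr do rewrite /s_ inord_val.
  by under [in RHS]eq_bigr do rewrite /s_ inord_val.
have s_E i j : s_ i j = submxblock s (inord i) (inord j) by [].
clearbody s_.
have ent0 U V : entry_mx U V (0, None) = 0 by rewrite /entry_mx scale0r.
have ent1 U V : entry_mx U V (1, None) = 1%:M by rewrite /entry_mx scale1r.
have entX U V : entry_mx U V (1, Some false) = U by rewrite /entry_mx scale1r.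
have entY U V : entry_mx U V (1, Some true) = V by rewrite /entry_mx scale1r.
have {}sarr_ i j : (i < 13)%N -> (j < 13)%N ->
    \sum_(k <- iota 0 4) s_ i k *m entry_mx X' Y' (arrow F k j)
  = \sum_(k <- iota 0 4) entry_mx X Y (arrow F i k) *m s_ k j.
  move=> i13 j13; have := sarr_ i j i13 j13.
  rewrite (_ : iota 0 13 = iota 0 4 ++ iota 4 9) //.
  have : forall k, k \in iota 4 9 -> (4 <= k)%N.
    by move=> k; rewrite mem_iota => /andP[].
  move: (iota 4 9) => idle_slots idle4; rewrite !big_cat /=.
  rewrite [X in _ + X]big1_seq => [|k /idle4 k4]; last first.
    by rewrite arrow_row0 ?ent0 ?mulmx0 // ltnW.
  rewrite [X in _ = _ + X]big1_seq ?addr0 // => k /idle4 k4.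
  by rewrite arrow_col0 ?ent0 ?mul0mx.
pose simp := (ent0, ent1, entX, entY,
  mulmx0, mul0mx, mulmx1, mul1mx, addr0, add0r).
have := sarr_ 0%N 1%N isT isT; have := sarr_ 1%N 2%N isT isT.
have := sarr_ 2%N 3%N isT isT; have := sarr_ 0%N 2%N isT isT.
have := sarr_ 1%N 3%N isT isT; have := sarr_ 4%N 1%N isT isT.
rewrite !big_cons !big_nil /= !simp.
rewrite [s_ 0%N 1%N]slab_ // [s_ 1%N 0%N]slab_ // [s_ 1%N 2%N]slab_ //.
rewrite [s_ 2%N 1%N]slab_ //.
rewrite [s_ 2%N 3%N]slab_ // [s_ 3%N 2%N]slab_ // !simp.
move=> s40 sY sX s23 s12 s01.
have us00 : s_ 0%N 0%N \in unitmx.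
  have := congr1 (fun M => submxblock M (inord 0%N) (inord 0%N)) (mulVmx us).
  rewrite submxblock_mul (bigD1 (inord 0%N)) //=.
  rewrite [X in _ + X]big1 => [|k k0]; last first.
    rewrite -[k]inord_val -s_E.
    have [k4|k4] := eqVneq (nat_of_ord k) 4%N; first by rewrite k4 s40 mulmx0.
    rewrite slab_ ?mulmx0 //; move: k0 k4; rewrite -val_eqE /= inordK //.
    by case: k => k; do 13 (case: k => [|k] //).
  rewrite addr0 -s_E -(@mxdiagZ F 13 (fun=> n.+1) 1) submxblock_diag.
  by case/mulmx1_unit.
exists (s_ 0%N 0%N); split=> //; rewrite -mulmxA.
  by rewrite {2}s01 s12 -sX mulKmx.
by rewrite {2}s01 s12 s23 -sY -s01 mulKmx.
Qed.

Lemma intertwiner_of_similar X Y X' Y' : similar_pairs X Y X' Y' ->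
  exists s : 'M[F]_N, [/\ s \in unitmx,
    s *m bA X' Y' = bA X Y *m s & s *m bB X' Y' = bB X Y *m s].
Proof.
case=> S [uS X'E Y'E]; pose s : 'M[F]_N := \mxdiag_(i < 13) S; exists s.
have sE e : s *m blocks X' Y' 13 e = blocks X Y 13 e *m s.
  rewrite mul_mxdiag_mxblock mul_mxblock_mxdiag; apply: eq_mxblock => i j.
  rewrite /entry_mx -scalemxAl -scalemxAr; congr (_ *: _).
  case: (e i j) => _ [[]|] /=; last by rewrite mulmx1 mul1mx.
    by rewrite Y'E -mulmxA mulKVmx.
  by rewrite X'E -mulmxA mulKVmx.
split=> //; have : s *m \mxdiag_(i < 13) invmx S = 1%:M.
  rewrite mul_mxdiag_mxblock -(mxdiagZ 1); apply: eq_mxblock => i j.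
  case: eqP => [E|]; rewrite ?mulmx0 //.
  by case: _ / E; rewrite !conform_mx_id mulmxV.
by case/mulmx1_unit.
Qed.


End Intertwiner.

(** * Reindexing block matrices *)

Section MatrixReindexing.

Variables (F : fieldType) (p q : nat) (phi : 'I_p -> 'I_q).
Hypothesis phi_bij : bijective phi.

Lemma mxsub_mulmx r t r' t' (f : 'I_r' -> 'I_r) (g : 'I_t' -> 'I_t)
    (K : 'M[F]_(r, q)) (L : 'M[F]_(q, t)) :
  mxsub f g (K *m L) = mxsub f phi K *m mxsub phi g L.
Proof.
apply/matrixP => i j; rewrite !mxE (reindex phi) /=; last exact: onW_bij.
by apply: eq_bigr => k _; rewrite !mxE.
Qed.

Lemma mxsub_inj : injective (@mxsub F q q p p phi phi).
Proof.
move=> K L KL; have [psi _ phiK] := phi_bij.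
apply/matrixP => i j; rewrite -[i]phiK -[j]phiK.
by have := congr1 (fun M : 'M_p => M (psi i) (psi j)) KL; rewrite !mxE.
Qed.

Lemma mxsub_congruence (S K : 'M[F]_q) :
  mxsub phi phi (S *m K *m S^T) =
  mxsub phi phi S *m mxsub phi phi K *m (mxsub phi phi S)^T.
Proof. by rewrite !mxsub_mulmx trmx_mxsub. Qed.

Lemma mxsub_unitmx (K : 'M[F]_q) : K \in unitmx -> mxsub phi phi K \in unitmx.
Proof.
move=> uK; have : mxsub phi phi K *m mxsub phi phi (invmx K) = 1%:M.
  rewrite -mxsub_mulmx mulmxV //; apply/matrixP => i j; rewrite !mxE.
  by rewrite (inj_eq (bij_inj phi_bij)).
by case/mulmx1_unit.
Qed.

End MatrixReindexing.

Section Flattening.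

Variables (F : fieldType) (n a b c : nat).

Definition lift_block_index p q (f : 'I_p -> 'I_q) (s : 'I_(\sum_(i < p) n)) :
    'I_(\sum_(i < q) n) :=
  @tagnat.Rank q (fun=> n) (f (tagnat.sig1 s)) (tagnat.sig2 s).

Lemma mxsub_lift_block_index p q p' q' (f : 'I_p -> 'I_q) (g : 'I_p' -> 'I_q')
    (B : 'I_q -> 'I_q' -> 'M[F]_n) :
  mxsub (lift_block_index f) (lift_block_index g) (\mxblock_(i < q, j < q') B i j)
  = \mxblock_(i < p, j < p') B (f i) (g j).
Proof.
apply/matrixP => s t; rewrite mxE [RHS]mxE /lift_block_index.
have <- := congr1 (fun K : 'M_n => K (tagnat.sig2 s) (tagnat.sig2 t))
  (mxblockK B (f (tagnat.sig1 s)) (g (tagnat.sig1 t))).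
by rewrite [RHS]mxE.
Qed.

(** [subst_mx] is indexed by one sum of n over all block indices, while the forms
    above are block matrices indexed by three such sums; this identifies the two
    index sets. *)
Definition split3_index
    (s : 'I_((\sum_(i < a) n) + ((\sum_(i < b) n) + (\sum_(i < c) n)))) :
    'I_(\sum_(i < a + (b + c)) n) :=
  match split s with
  | inl u => lift_block_index (@lshift a (b + c)) u
  | inr t => match split t with
             | inl v => lift_block_index (fun i => rshift a (@lshift b c i)) v
             | inr w => lift_block_index (fun i => rshift a (@rshift b c i)) w
             end
  end.

Lemma split3_index_bij : bijective split3_index.
Proof.
have sig1_flat p q (f : 'I_p -> 'I_q) s :
    tagnat.sig1 (lift_block_index f s) = f (tagnat.sig1 s).
  by rewrite /lift_block_index tagnat.Rank1K.
have flat_inj p q (f : 'I_p -> 'I_q) : injective f -> injective (lift_block_index f).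
  move=> f_inj s t /(congr1 val) /eqP.
  rewrite tagnat.eq_Rank => /andP[/eqP/f_inj st1 /eqP st2].
  rewrite -[s]tagnat.sig2K -[t]tagnat.sig2K; apply/val_inj/eqP.
  by rewrite tagnat.eq_Rank st1 st2 !eqxx.
apply: inj_card_bij; last by rewrite !card_ord !sum_nat_const !card_ord !mulnDl.
move=> s t; rewrite /split3_index.
have flat_disj p p' q (f : 'I_p -> 'I_q) (g : 'I_p' -> 'I_q) u v :
    (forall i j, f i != g j) -> lift_block_index f u = lift_block_index g v -> False.
  move=> fg /(congr1 (fun w => tagnat.sig1 w)); rewrite !sig1_flat => /eqP.
  by rewrite (negPf (fg _ _)).
case: (split_ordP s) => u ->; case: (split_ordP t) => v ->.
- by move/flat_inj => -> //; apply: lshift_inj.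
- by case: (split_ordP v) => w _ /flat_disj[] i j; rewrite eq_lrshift.
- by case: (split_ordP u) => w _ /flat_disj[] i j; rewrite eq_rlshift.
case: (split_ordP u) => u' ->; case: (split_ordP v) => v' ->.
- by move/flat_inj => -> // i j /rshift_inj/lshift_inj.
- by move/flat_disj => [] i j; rewrite eq_rshift eq_lrshift.
- by move/flat_disj => [] i j; rewrite eq_rshift eq_rlshift.
- by move/flat_inj => -> // i j /rshift_inj/rshift_inj.
Qed.

Lemma mxsub_split3 (B : 'I_(a + (b + c)) -> 'I_(a + (b + c)) -> 'M[F]_n)
    (f := lshift (b + c)) (g := fun i => rshift a (lshift c i))
    (h := fun i => rshift a (rshift b i)) :
  mxsub split3_index split3_index (\mxblock_(i, j) B i j) =
  block_mx (\mxblock_(i, j) B (f i) (f j))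
    (row_mx (\mxblock_(i, j) B (f i) (g j)) (\mxblock_(i, j) B (f i) (h j)))
    (col_mx (\mxblock_(i, j) B (g i) (f j)) (\mxblock_(i, j) B (h i) (f j)))
    (block_mx (\mxblock_(i, j) B (g i) (g j)) (\mxblock_(i, j) B (g i) (h j))
              (\mxblock_(i, j) B (h i) (g j)) (\mxblock_(i, j) B (h i) (h j))).
Proof.
have phi_f u : split3_index (lshift _ u) = lift_block_index f u.
  by rewrite /split3_index (unsplitK (inl u)).
have phi_g u : split3_index (rshift _ (lshift _ u)) = lift_block_index g u.
  by rewrite /split3_index (unsplitK (inr _)) (unsplitK (inl u)).
have phi_h u : split3_index (rshift _ (rshift _ u)) = lift_block_index h u.
  by rewrite /split3_index (unsplitK (inr _)) (unsplitK (inr u)).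
have restrict p p' (k : 'I_(\sum_(i < p) n) -> _)
    (l : 'I_(\sum_(i < p') n) -> _) k' l' :
    (forall u, k u = lift_block_index k' u) -> (forall u, l u = lift_block_index l' u) ->
    mxsub k l (\mxblock_(i, j) B i j) = \mxblock_(i, j) B (k' i) (l' j).
  by move=> kE lE; apply: etrans (mxsub_lift_block_index _ _ _); apply: eq_mxsub.
rewrite -[LHS]submxK ulsubmxEsub ursubmxEsub dlsubmxEsub drsubmxEsub.
congr block_mx; first by rewrite -mxsub_comp; apply: restrict.
- rewrite -[LHS]hsubmxK lsubmxEsub rsubmxEsub -!mxsub_comp.
  by congr row_mx; apply: restrict.
- rewrite -[LHS]vsubmxK usubmxEsub dsubmxEsub -!mxsub_comp.
  by congr col_mx; apply: restrict.
rewrite -[LHS]submxK ulsubmxEsub ursubmxEsub dlsubmxEsub drsubmxEsub.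
rewrite -!mxsub_comp.
by congr block_mx; apply: restrict.
Qed.

End Flattening.

(** * The triple of matrices of noncommutative polynomials *)

Section WildTable.

Variables (F : fieldType) (eps : F) (alpha : seq F).

Definition monomial (transposed : bool) (e : entry F) : ncpoly F :=
  << e.1 *g FMonom (if e.2 is Some b then [:: inord (transposed.*2 + b) : 'I_4]
                    else [::]) >>.

(** The two halves of the pencil at the k-th coordinate vector: [I | 0], [0 | I]
    and [A~ | B~]. *)
Definition table_entry_l (k : nat) (i j : nat) : entry F :=
  match k with
  | 0 => diag_entry 1 i j
  | 1 => (0, None)
  | _ => entryA alpha i j
  end.

Definition table_entry_r (k : nat) (i j : nat) : entry F :=
  match k with
  | 0 => (0, None)
  | 1 => diag_entry 1 i j
  | _ => entryB alpha i j
  end.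

Definition scale_entry (e : entry F) : entry F := (eps * e.1, e.2).

Definition wild_table (k : 'I_3) : 'M[ncpoly F]_(13 + (13 + 13)) :=
  block_mx 0
    (row_mx (\matrix_(i, j) monomial false (table_entry_l k i j))
            (\matrix_(i, j) monomial false (table_entry_r k i j)))
    (col_mx (\matrix_(i, j) monomial true (scale_entry (table_entry_l k j i)))
            (\matrix_(i, j) monomial true (scale_entry (table_entry_r k j i))))
    0.

Variable n : nat.
Implicit Types X Y : 'M[F]_n.+1.

Local Notation N := (\sum_(i < 13) n.+1)%N.
Local Notation bA X Y := (blocks X Y 13 (entryA alpha)).
Local Notation bB X Y := (blocks X Y 13 (entryB alpha)).

Definition vpencil M (A B : 'M[F]_M) (v : 'cV[F]_3) : 'M[F]_(M, M + M) :=
  pencil A B (v (inord 0) 0) (v (inord 1) 0) (v (inord 2) 0).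

Lemma off_diag_vpencil_is_linear M (A B : 'M[F]_M) :
  linear (fun v => off_diag eps (vpencil A B v)).
Proof.
move=> c u v; rewrite /off_diag scale_block_mx add_block_mx !scaler0 !addr0.
have -> : vpencil A B (c *: u + v) = c *: vpencil A B u + vpencil A B v.
  rewrite /vpencil /pencil scale_row_mx add_row_mx !mxE.
  congr row_mx; rewrite scalerDr scale_scalar_mx scalerA scalerDl addrACA;
  by rewrite -raddfD.
congr block_mx.
by rewrite linearP /= scalerDr !scalerA mulrC.
Qed.

Lemma monomial_value X Y transposed e :
  ncpoly_value X Y (monomial transposed e) =
  if transposed then (entry_mx X Y e)^T else entry_mx X Y e.
Proof.
rewrite /ncpoly_value /monomial mmapU /word_value /entry_mx.
case: e => c [b|] /=; rewrite ?big_cons big_nil mulr1; last first.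
  by rewrite scalemx1; case: transposed; rewrite ?tr_scalar_mx.
rewrite -mulmxE mul_scalar_mx (tnth_nth 0) inordK; last first.
  by case: transposed b => [] [].
by case: transposed b => [] []; rewrite // linearZ.
Qed.

Lemma vpencil_entries X Y (k : 'I_3) :
  vpencil (bA X Y) (bB X Y) (delta_mx k 0) =
  row_mx (blocks X Y 13 (table_entry_l k)) (blocks X Y 13 (table_entry_r k)).
Proof.
have diag1 : blocks X Y 13 (diag_entry 1) = 1%:M.
  rewrite -(@mxdiagZ F 13 (fun=> n.+1) 1); apply: eq_mxblock => i j.
  rewrite entry_diagE val_eqE; case: eqP => [E|_]; last by rewrite raddf0.
  by case: _ / E; rewrite conform_mx_id.
have zero : blocks X Y 13 (fun _ _ => (0, None)) = 0.
  rewrite -[RHS]mxblock0; apply: eq_mxblock => i j.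
  by rewrite /entry_mx scale0r.
rewrite /vpencil !mxE -!val_eqE /= !inordK // !andbT.
case: k => [[|[|[|//]]] ?] /=;
  by rewrite ?(pencil100, pencil010, pencil001) /table_entry_l /table_entry_r
             ?diag1 ?zero.
Qed.

Lemma wild_table_blocks X Y k :
  mxsub (@split3_index n.+1 13 13 13) (@split3_index n.+1 13 13 13)
    (subst_table wild_table X Y k) =
  off_diag eps (vpencil (bA X Y) (bB X Y) (delta_mx k 0)).
Proof.
have value0 : ncpoly_value X Y 0 = 0 by exact: mmap0.
have tr_scaled p e : (\mxblock_(i < p, j < p)
      ncpoly_value X Y (monomial true (scale_entry (e j i)))
      : 'M_(\sum_(i < p) n.+1))
    = eps *: (\mxblock_(i < p, j < p) entry_mx X Y (e i j))^T.
  rewrite tr_mxblock; apply/matrixP => s t; rewrite !mxE.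
  by rewrite monomial_value /entry_mx /= -scalerA linearZ !mxE.
rewrite vpencil_entries /off_diag tr_row_mx scale_col_mx -!tr_scaled.
rewrite /subst_table /subst_mx mxsub_split3 /wild_table; congr block_mx.
- rewrite -[RHS]mxblock0; apply: eq_mxblock => i j.
  by rewrite block_mxEul mxE value0.
- congr row_mx; apply: eq_mxblock => i j;
    by rewrite block_mxEur ?row_mxEl ?row_mxEr mxE monomial_value.
- congr col_mx; apply: eq_mxblock => i j;
    by rewrite block_mxEdl ?col_mxEu ?col_mxEd mxE.
rewrite -[RHS]block_mx0; congr block_mx; rewrite -[RHS]mxblock0;
  apply: eq_mxblock => i j;
  by rewrite block_mxEdr mxE value0.
Qed.

Lemma off_diag_vpencilE M (A B : 'M[F]_M) (v : 'cV[F]_3) :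
  off_diag eps (vpencil A B v) =
  \sum_k v k 0 *: off_diag eps (vpencil A B (delta_mx k 0)).
Proof.
pose h : {linear 'cV[F]_3 -> 'M[F]_(M + (M + M))} :=
  HB.pack (fun v => off_diag eps (vpencil A B v))
    (GRing.isLinear.Build _ _ _ _ _ (off_diag_vpencil_is_linear A B)).
rewrite {1}[v]matrix_sum_delta -[LHS]/(h _) linear_sum; apply: eq_bigr => k _.
by rewrite big_ord1 linearZ.
Qed.

End WildTable.

(** * Isomorphism of the assigned algebras is similarity of the pairs *)

Section Wildness.

Variables (F : fieldType) (eps : F) (alpha : seq F) (n : nat).
Hypotheses (eps0 : eps != 0).
Hypotheses (alpha_uniq : uniq alpha) (alpha_size : size alpha = 4%N).
Implicit Types X Y A B C D : 'M[F]_n.+1.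

Local Notation N := (\sum_(i < 13) n.+1)%N.
Local Notation bA X Y := (blocks X Y 13 (entryA alpha)).
Local Notation bB X Y := (blocks X Y 13 (entryB alpha)).
Local Notation T X Y := (subst_table (wild_table eps alpha) X Y).
Local Notation phi := (@split3_index n.+1 13 13 13).
Local Notation phi_bij := (@split3_index_bij n.+1 13 13 13).

Lemma rank_vpencil_moment X Y l : (l < 4)%N ->
  (\rank (vpencil (bA X Y) (bB X Y) (moment_point alpha`_l))
   + l.+1 * n.+1 = N)%N.
Proof.
by move=> l4; rewrite /vpencil !mxE !inordK //=; apply: rank_pencil_moment.
Qed.

Lemma vpencilZ M (A B : 'M[F]_M) c v :
  vpencil A B (c *: v) = c *: vpencil A B v.
Proof. by rewrite /vpencil !mxE pencil_scale. Qed.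

(** The rank drops only at multiples of the four points of the curve, and there
    by four different amounts. *)
Lemma moment_point_of_rank X Y l (v : 'cV[F]_3) : (l < 4)%N -> v != 0 ->
    (\rank (vpencil (bA X Y) (bB X Y) v) + l.+1 * n.+1 = N)%N ->
  exists lam, v = lam *: moment_point alpha`_l.
Proof.
move=> l4 v0 rv.
have [/existsP[l' /eqP vE]|] := boolP [exists l' : 'I_4,
    v == v (inord 2) 0 *: moment_point alpha`_l'].
  exists (v (inord 2) 0); rewrite {1}vE; congr (_ *: moment_point alpha`_ _).
  have z0 : v (inord 2) 0 != 0.
    by apply: contra_neq v0 => z0; rewrite vE z0 scale0r.
  move: rv; rewrite vE vpencilZ (eqmx_scale _ z0).
  move/esym/(etrans (rank_vpencil_moment X Y (ltn_ord l')))/addnI.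
  by move/eqP; rewrite eqn_pmul2r // eqSS => /eqP.
rewrite negb_exists => /forallP off; move: rv; rewrite rank_pencil_generic //.
- by rewrite -[X in _ = X]addn0 => /addnI/eqP; rewrite muln_eq0.
- apply: contraNT v0; rewrite !negb_or !negbK => /and3P[x0 y0 z0].
  apply/eqP/colP => i; rewrite mxE -[i]inord_val; apply/eqP.
  by case: i => [[|[|[|//]]] ?].
move=> l' l'4; apply: contra (off (Ordinal l'4)) => /eqP[xE yE].
apply/eqP/colP => i; rewrite !mxE -[i]inord_val inordK //.
by case: i => [[|[|[|//]]] ?]; rewrite /= ?xE ?yE ?mulr1.
Qed.

(** For every v the congruence matches the form at v with the form at g v, so
    the ranks of the two pencils agree; at the four points of the curve this
    pins g down to a scalar. *)
Lemma similar_of_congruence A B C D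
    (S : 'M[F]_(\sum_(i < 13 + (13 + 13)) n.+1)) (g : 'M[F]_3) :
    S \in unitmx -> g \in unitmx ->
    (forall k, S *m T C D k *m S^T = \sum_l g l k *: T A B l) ->
  similar_pairs A B C D.
Proof.
move=> uS ug congS; pose S' := mxsub phi phi S.
have uS' : S' \in unitmx by apply: mxsub_unitmx => //; apply: phi_bij.
have congS' v : S' *m off_diag eps (vpencil (bA C D) (bB C D) v) *m S'^T
              = off_diag eps (vpencil (bA A B) (bB A B) (g *m v)).
  rewrite (off_diag_vpencilE _ _ _ v) (off_diag_vpencilE _ _ _ (g *m v)).
  rewrite mulmx_sumr mulmx_suml.
  under [RHS]eq_bigr do rewrite mxE scaler_suml.
  rewrite exchange_big; apply: eq_bigr => k _ /=.
  rewrite -scalemxAr -scalemxAl -wild_table_blocks.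
  rewrite -mxsub_congruence; last exact: phi_bij.
  rewrite congS; under [RHS]eq_bigr do rewrite mulrC -scalerA -wild_table_blocks.
  rewrite -scaler_sumr; congr (_ *: _); apply/matrixP => i j.
  by rewrite mxE !summxE; apply: eq_bigr => l _; rewrite !mxE.
have [lam gE] : exists lam, g = lam%:M.
  apply: (moment_curve_rigid alpha_uniq alpha_size) => a a_alpha.
  have [l l4 <-] := nthP 0 a_alpha; rewrite alpha_size in l4.
  apply: (@moment_point_of_rank A B l _ l4).
    apply: contraTneq isT => gv0.
    have : moment_point alpha`_l = 0 by rewrite -[LHS](mulKmx ug) gv0 mulmx0.
    move/colP/(_ (inord 2)); rewrite !mxE inordK //= => /eqP.
    by rewrite oner_eq0.
  apply: etrans (rank_vpencil_moment C D l4); congr (_ + _)%N; apply: double_inj.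
  rewrite -!(rank_off_diag _ eps0) -congS'.
  rewrite mxrankMfree ?row_free_unit ?unitmx_tr //.
  by rewrite (eqmxMfull _ (_ : row_full S')) // row_full_unit.
have lam0 : lam != 0.
  apply: contraTneq ug => lam0.
  by rewrite gE lam0 raddf0 unitmxE det0 unitr0.
have [|s [us sA sB]] := @congruence_rigid F N eps lam
  (bA A B) (bB A B) (bA C D) (bB C D) S' eps0 lam0 uS'.
  move=> x y z; pose v : 'cV[F]_3 := \col_k [:: x; y; z]`_k.
  have pE (K L : 'M[F]_N) : pencil K L x y z = vpencil K L v.
    by rewrite /vpencil !mxE !inordK.
  by rewrite !pE congS' gE mul_scalar_mx vpencilZ off_diagZ.
exact: (similar_of_intertwiner alpha_uniq alpha_size us).
Qed.

Lemma congruence_of_similar A B C D : similar_pairs A B C D ->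
  exists2 S : 'M[F]_(\sum_(i < 13 + (13 + 13)) n.+1), S \in unitmx &
    forall k, S *m T C D k *m S^T = T A B k.
Proof.
move=> /(intertwiner_of_similar alpha)[s [us sA sB]].
have [S uS congS] := congruence_of_intertwiner eps us sA sB.
have [psi psiK phiK] := phi_bij.
have phipsi K : mxsub phi phi (mxsub psi psi K) = K.
  by apply/matrixP => i j; rewrite !mxE !psiK.
exists (mxsub psi psi S).
  by apply: mxsub_unitmx => //; exists phi.
move=> k; apply: (mxsub_inj phi_bij).
by rewrite (mxsub_congruence phi_bij) !wild_table_blocks phipsi congS.
Qed.

(** The products at the three index pairs are e_0 and e_1, up to multiples of
    e_2, and e_2 itself. *)
Lemma products_span_of_entries M (K : 'I_3 -> 'M[F]_M) i0 j0 i1 j1 i2 j2 :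
    K (inord 0) i0 j0 = 1 -> K (inord 1) i0 j0 = 0 ->
    K (inord 0) i1 j1 = 0 -> K (inord 1) i1 j1 = 1 ->
    K (inord 0) i2 j2 = 0 -> K (inord 1) i2 j2 = 0 -> K (inord 2) i2 j2 = 1 ->
  products_span K.
Proof.
move=> K00 K01 K10 K11 K20 K21 K22 P P0 Plin Pmul.
have PZ c x : P x -> P (c *: x).
  by move=> Px; rewrite -[_ *: _]addr0; apply: Plin.
have PD x y : P x -> P y -> P (x + y).
  by move=> Px Py; rewrite -[x]scale1r; apply: Plin.
have ffE i j : amul (basis_f K i) (basis_f K j) =
    K (inord 0) i j *: basis_e K (inord 0)
    + K (inord 1) i j *: basis_e K (inord 1)
    + K (inord 2) i j *: basis_e K (inord 2).
  by rewrite amul_ff sum3E.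
have P2 : P (basis_e K (inord 2)).
  have := Pmul (basis_f K i2) (basis_f K j2).
  by rewrite ffE K20 K21 K22 !scale0r !add0r scale1r.
have P1 : P (basis_e K (inord 1)).
  have := Plin (- K (inord 2) i1 j1) _ _ P2 (Pmul (basis_f K i1) (basis_f K j1)).
  rewrite ffE K10 K11 scale0r add0r scale1r.
  by rewrite addrCA -scalerDl addNr scale0r addr0.
have P0' : P (basis_e K (inord 0)).
  have := Plin (- K (inord 2) i0 j0) _ _ P2 (Pmul (basis_f K i0) (basis_f K j0)).
  rewrite ffE K00 K01 scale0r addr0 scale1r.
  by rewrite addrCA -scalerDl addNr scale0r addr0.
move=> e; have -> : (e, 0) = e 0 (inord 0) *: basis_e K (inord 0)
    + e 0 (inord 1) *: basis_e K (inord 1)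
    + e 0 (inord 2) *: basis_e K (inord 2).
  congr pair; last by rewrite /= !scaler0 !addr0.
  by rewrite /= [LHS]row_sum_delta sum3E.
exact: PD _ _ (PD _ _ (PZ _ _ P0') (PZ _ _ P1)) (PZ _ _ P2).
Qed.

Lemma wild_table_products_span A B : products_span (T A B).
Proof.
pose slot (i : 'I_13) : 'I_N := @tagnat.Rank _ (fun=> n.+1) i 0.
pose u i := phi (lshift _ (slot i)).
pose v i := phi (rshift _ (lshift _ (slot i))).
pose w i := phi (rshift _ (rshift _ (slot i))).
have corner (e : nat -> nat -> entry F) (i j : 'I_13) :
    blocks A B 13 e (slot i) (slot j) = entry_mx A B (e i j) 0 0.
  have <- := congr1 (fun K : 'M_n.+1 => K 0 0)
    (mxblockK (fun i j : 'I_13 => entry_mx A B (e i j)) i j).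
  by rewrite [RHS]mxE.
have form k i j : T A B k (phi i) (phi j) =
    off_diag eps (vpencil (bA A B) (bB A B) (delta_mx k 0)) i j.
  by rewrite -wild_table_blocks [RHS]mxE.
have uv k i j : T A B k (u i) (v j)
   = entry_mx A B (table_entry_l alpha k i j) 0 0.
  by rewrite form vpencil_entries /off_diag block_mxEur row_mxEl corner.
have uw k i j : T A B k (u i) (w j)
   = entry_mx A B (table_entry_r alpha k i j) 0 0.
  by rewrite form vpencil_entries /off_diag block_mxEur row_mxEr corner.
(* The arrow 0 -> 1 of B~ provides an entry where only the third form is not
   zero. *)
apply: (@products_span_of_entries _ _
          (u 0) (v 0) (u 0) (w 0) (u 0) (w (inord 1)));
  by rewrite ?uv ?uw !inordK // !mxE /= ?mulr1 ?mul0r.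
Qed.

End Wildness.

Lemma wild_table_sym (F : fieldType) (alpha : seq F) n (A B : 'M[F]_n.+1) k :
  (subst_table (wild_table 1 alpha) A B k)^T
  = subst_table (wild_table 1 alpha) A B k.
Proof.
apply: (mxsub_inj (@split3_index_bij n.+1 13 13 13)).
rewrite -trmx_mxsub wild_table_blocks /off_diag tr_block_mx !trmx0.
by rewrite linearZ /= trmxK !scale1r.
Qed.

Lemma wild_table_alt (F : fieldType) (alpha : seq F) n (A B : 'M[F]_n.+1) k u :
  u *m subst_table (wild_table (- 1) alpha) A B k *m u^T = 0 :> 'M_1.
Proof.
have phi_bij := @split3_index_bij n.+1 13 13 13.
rewrite -[LHS]mxsub_id !(mxsub_mulmx phi_bij) wild_table_blocks -trmx_mxsub.
move: (mxsub _ _ u) => v; rewrite -[v]hsubmxK /off_diag.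
move: (lsubmx v) (rsubmx v) (vpencil _ _ _) => x y P.
rewrite mul_row_block tr_row_mx mul_row_col !mulmx0 addr0 add0r.
rewrite scaleN1r mulmxN mulNmx.
have -> : y *m P^T *m x^T = (x *m P *m y^T)^T.
  by rewrite !trmx_mul trmxK mulmxA.
by apply/matrixP => i j; rewrite !ord1 !mxE addNr.
Qed.

Lemma four_distinct (F : closedFieldType) :
  exists2 alpha : seq F, uniq alpha & size alpha = 4%N.
Proof.
suff /(_ 4%N) [alpha] :
    forall k, exists2 alpha : seq F, uniq alpha & size alpha = k.
  by exists alpha.
elim=> [|k [alpha alpha_uniq alpha_size]]; first by exists [::].
have /closed_nonrootP[a] : \prod_(b <- alpha) ('X - b%:P) != 0.
  by apply: monic_neq0; apply: monic_prod_XsubC.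
rewrite root_prod_XsubC => a_alpha.
by exists (a :: alpha); rewrite /= ?a_alpha ?alpha_size.
Qed.

Theorem theorem4 (F : closedFieldType) (charF : 2%N \notin [pchar F]%R) :
  local_wild F /\ lie_wild F.
Proof.
have [alpha alpha_uniq alpha_size] := four_distinct F.
have N1 : - 1 != 0 :> F by rewrite oppr_eq0 oner_neq0.
split.
  exists (13 + (13 + 13))%N, (wild_table 1 alpha) => n; split=> [A B|A B C D].
    split; first exact: unitization_radical.
    apply: unitization_local_class; first exact: wild_table_products_span.
    exact: wild_table_sym.
  split=> [/(congruence_of_similar 1 alpha)[S uS congS]|].
    apply: unitization_iso_of_table_iso.
    exact: table_iso_of_congruence uS congS.
  move/table_iso_of_unitization_iso; case/congruence_of_table_iso.
    exact: wild_table_products_span.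
  move=> S [g [uS ug congS]].
  exact: (similar_of_congruence (oner_neq0 F)
            alpha_uniq alpha_size uS ug congS).
exists (13 + (13 + 13))%N, (wild_table (- 1) alpha) => n; split=> [A B|A B C D].
  apply: table_alg_lie_class; first exact: wild_table_products_span.
  exact: wild_table_alt.
split=> [/(congruence_of_similar (- 1) alpha)[S uS congS]|].
  exact: table_iso_of_congruence uS congS.
case/congruence_of_table_iso; first exact: wild_table_products_span.
move=> S [g [uS ug congS]].
exact: (similar_of_congruence N1 alpha_uniq alpha_size uS ug congS).
Qed.
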